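(* Let $\mu>0$ and let $g:\mathcal{Z}\to\mathcal{Z}^*$ be a (continuous) gradient mapping that is $\mu$-strongly monotone relative to the distance generating function $r$, where $\max_{z\in\mathcal Z} r(z)-\min_{z\in\mathcal Z} r(z)\le\Theta$. Let $\mathcal{O}$ be an $(\alpha,\varepsilon)$-relaxed proximal oracle for $g$, and let $z^\star$ be the unique point of $\mathcal{Z}$ with $\max_{u\in\mathcal{Z}}\langle g(z^\star),z^\star-u\rangle\le0$. Let $z_0=\operatorname*{arg\,min}_{z\in\mathcal{Z}}r(z)$ and, for $k=1,\dots,K$, $$z_{k-1/2}=\mathcal{O}(z_{k-1}),\qquad z_k=\operatorname*{arg\,min}_{z\in\mathcal{Z}}\Big\{\langle g(z_{k-1/2}),z\rangle+\alpha V_{z_{k-1}}(z)+\mu V_{z_{k-1/2}}(z)\Big\}.$$ Then $$\mathbb{E}\,V_{z_K}(z^\star)\le\left(\frac{\alpha}{\mu+\alpha}\right)^K\Theta+\frac{\varepsilon}{\mu}.$$ If in addition $g(z)=(\nabla_xf(z),-\nabla_yf(z))$ is the gradient mapping of a function $f:\mathcal{X}\times\mathcal{Y}\to\mathbb{R}$ (differentiable, convex in $x$, concave in $y$) and $\|(\nabla_xf(z),-\nabla_yf(z'))\|_*\le G$ for all $z,z'\in\mathcal{Z}$, then $$\mathbb{E}\,\mathrm{Gap}(z_K)\le\sqrt2\,G\sqrt{\left(\frac{\alpha}{\mu+\alpha}\right)^K\Theta+\frac{\varepsilon}{\mu}}.$$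
   Context: Setup: $\mathcal{Z}=\mathcal{X}\times\mathcal{Y}$ with $\mathcal{X}\subset\mathbb{R}^n$, $\mathcal{Y}\subset\mathbb{R}^m$ convex and compact; $z^{\mathsf x},z^{\mathsf y}$ denote the $\mathcal X$ and $\mathcal Y$ components of $z$; $\|\cdot\|$ is a norm, with dual norm $\|\zeta\|_*=\max_{\|z\|\le1}\langle\zeta,z\rangle$. The distance generating function $r:\mathcal{Z}\to\mathbb{R}$ is $1$-strongly convex: $r(z')\ge r(z)+\langle\nabla r(z),z'-z\rangle+\frac12\|z'-z\|^2$ for all $z,z'\in\mathcal{Z}$ (for non-differentiable $r$, $\langle\nabla r(z),w\rangle:=\sup_{\gamma\in\partial r(z)}\langle\gamma,w\rangle$). The Bregman divergence is $V_z(z')=r(z')-r(z)-\langle\nabla r(z),z'-z\rangle\ge\frac12\|z'-z\|^2$; it satisfies $-\langle\nabla V_z(z'),z'-u\rangle=V_z(u)-V_{z'}(u)-V_z(z')$. $g$ is $\mu$-strongly monotone relative to $r$ if $\langle g(z')-g(z),z'-z\rangle\ge\mu V_{z'}(z)$ for all $z,z'\in\mathcal{Z}$. An $(\alpha,\varepsilon)$-relaxed proximal oracle for $g$ ($\alpha>0$, $\varepsilon\ge0$) is a (possibly randomized) map $\mathcal{O}:\mathcal{Z}\to\mathcal{Z}$ such that $z'=\mathcal{O}(z)$ satisfies $\mathbb{E}[\max_{u\in\mathcal{Z}}\{\langle g(z'),z'-u\rangle-\alpha V_z(u)\}]\le\varepsilon$; each call uses fresh independent randomness. $\mathrm{Gap}(z)=\max_{y'\in\mathcal{Y}}f(z^{\mathsf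 x},y')-\min_{x'\in\mathcal{X}}f(x',z^{\mathsf y})$. *)

(* Defs.v *)
From mathcomp Require Export all_boot all_order all_algebra.
From mathcomp Require Export all_classical all_reals all_analysis.
Export numFieldNormedType.Exports.

Set Implicit Arguments.
Unset Strict Implicit.
Unset Printing Implicit Defensive.

Import Order.TTheory GRing.Theory Num.Theory.
Local Open Scope classical_set_scope.
Local Open Scope ring_scope.

Section Euclidean.
Context {R : realType} {d : nat}.
Implicit Types (Z : set 'rV[R]_d) (N : 'rV[R]_d -> R).

Definition dot (u v : 'rV[R]_d) : R := \sum_i u 0 i * v 0 i.

(* N is an arbitrary norm; the topology of 'rV[R]_d is the library's, which
   every norm induces in finite dimension. *)
Definition is_norm N : Prop :=
  [/\ forall u v, N (u + v) <= N u + N v,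
      forall (a : R) u, N (a *: u) = `|a| * N u
    & forall u, N u = 0 -> u = 0].

Definition dual_norm N (q : 'rV[R]_d) : \bar R :=
  ereal_sup [set (dot q w)%:E | w in [set w | N w <= 1]].

Definition is_argmin Z (F : 'rV[R]_d -> \bar R) (z : 'rV[R]_d) : Prop :=
  Z z /\ forall u, Z u -> (F z <= F u)%E.

(* The linear form dot q is a Frechet derivative of f at z along Z. At interior
   points of Z this is the usual gradient; the values of f off Z play no role. *)
Definition gradient_within Z (f : 'rV[R]_d -> R) (z q : 'rV[R]_d) : Prop :=
  (fun u => (f u - f z - dot q (u - z)) / `|u - z|) @ within Z z^' --> (0 : R).

End Euclidean.

Section Bregman.
Context {R : realType} {d : nat}.
Implicit Types (Z : set 'rV[R]_d) (r : 'rV[R]_d -> R) (z u w : 'rV[R]_d).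

Definition subdifferential Z r z : set 'rV[R]_d :=
  [set q | forall u, Z u -> r z + dot q (u - z) <= r u].

(* <grad r(z), w>, as the supremum of <q, w> over subgradients q, with value
   -oo if there are none. It is only used for w = u - z with u in Z; for such
   w, if r is convex on Z and differentiable at z, the normal cone of Z
   contributes nothing and this is the usual <grad r(z), w>. *)
Definition grad_pairing Z r z w : \bar R :=
  ereal_sup [set (dot q w)%:E | q in subdifferential Z r z].

Definition distance_generating (N : 'rV[R]_d -> R) Z r : Prop :=
  forall z u, Z z -> Z u ->
    ((r z)%:E + grad_pairing Z r z (u - z) + (2^-1 * N (u - z) ^+ 2)%:E
       <= (r u)%:E)%E.

(* bregman Z r z u is V_z(u). *)
Definition bregman Z r z u : \bar R :=
  ((r u)%:E - (r z)%:E - grad_pairing Z r z (u - z))%E.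

Definition strongly_monotone_rel (mu : R) Z r (g : 'rV[R]_d -> 'rV[R]_d) : Prop :=
  forall u z, Z u -> Z z ->
    (mu%:E * bregman Z r u z <= (dot (g u - g z) (u - z))%:E)%E.

Definition VI_solution Z (g : 'rV[R]_d -> 'rV[R]_d) z : Prop :=
  Z z /\ (ereal_sup [set (dot (g z) (z - u))%:E | u in Z] <= 0)%E.

End Bregman.

Local Notation borel_rV R d := (g_sigma_algebraType (@open 'rV[R]_d)).

(* A randomized map is a deterministic map O z s of the point z and of a random
   seed s with law Q; joint measurability is what makes the expectations of
   iterated calls meaningful. *)
Definition relaxed_proximal_oracle (R : realType) (d : nat)
    (Z : set 'rV[R]_d) (r : 'rV[R]_d -> R) (g : 'rV[R]_d -> 'rV[R]_d)
    (alpha eps : R) (dS : measure_display) (S : measurableType dS)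
    (Q : probability S R) (O : 'rV[R]_d -> S -> 'rV[R]_d) : Prop :=
  [/\ measurable_fun ((Z : set (borel_rV R d)) `*` [set: S])
        ((fun p => O p.1 p.2) : borel_rV R d * S -> borel_rV R d),
      forall z s, Z z -> Z (O z s)
    & forall z, Z z ->
        (\int[Q]_s ereal_sup
            [set (dot (g (O z s)) (O z s - u))%:E - alpha%:E * bregman Z r z u
              | u in Z] <= eps%:E)%E].

Definition mutually_independent (R : realType)
    (dO dS : measure_display) (Omega : measurableType dO)
    (S : measurableType dS) (P : probability Omega R) (I : finType)
    (xi : I -> {mfun Omega >-> S}) : Prop :=
  forall (J : {set I}) (A : I -> set S), (forall i, measurable (A i)) ->
    P (\bigcap_(i in [set` J]) xi i @^-1` A i)
      = (\prod_(i in J) P (xi i @^-1` A i))%E.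

Section Game.
Context {R : realType} {n m : nat}.
Implicit Types (X : set 'rV[R]_n) (Y : set 'rV[R]_m).

(* Points of R^n x R^m are row vectors of size n + m, with components
   lsubmx z and rsubmx z. *)
Definition product_domain X Y : set 'rV[R]_(n + m) :=
  [set z | X (lsubmx z) /\ Y (rsubmx z)].

Definition gap X Y (f : 'rV[R]_n -> 'rV[R]_m -> R) (z : 'rV[R]_(n + m)) : \bar R :=
  (ereal_sup [set (f (lsubmx z) y)%:E | y in Y]
   - ereal_inf [set (f x (rsubmx z))%:E | x in X])%E.

Definition convex_concave X Y (f : 'rV[R]_n -> 'rV[R]_m -> R) : Prop :=
  (forall y, Y y -> convex_function X (f^~ y)) /\
  (forall x, X x -> convex_function Y (fun y => - f x y)).

End Game.

(* Main.v *)
(* The hypotheses force regularity that is not assumed of r. Since mu > 0, strong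
   monotonicity makes every Bregman divergence finite, so r has subgradients
   everywhere on Z; continuity of g then gives
   V_z(u) <= <g(z) - g(u), z - u> / mu = o(|z - u|), so each map
   u |-> <grad r(z), u - z> is affine on Z. Hence the proximal step satisfies the
   usual three-point inequality, and with strong monotonicity at the solution zs
   it gives, pathwise,
     (alpha + mu) V_{z_{k+1}}(zs) <= alpha V_{z_k}(zs) + e_k,
   where e_k = max_u {<g(z_{k+1/2}), z_{k+1/2} - u> - alpha V_{z_k}(u)} has mean at
   most eps by independence of z_k and the k-th seed. The iterates are measurable
   because r is lower semicontinuous and the argmin is unique. For the gap,
   Gap(z) <= G N(z - zs) <= G sqrt(2 V_z(zs)), and Jensen's inequality for the
   square root follows from 2 sqrt V <= V / c + c. *)
From HB Require Import structures.
Require Import Defs.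
From mathcomp Require Import ring lra measurable_realfun.

Set Implicit Arguments.
Unset Strict Implicit.
Unset Printing Implicit Defensive.

Import Order.TTheory GRing.Theory Num.Theory.
Local Open Scope classical_set_scope.
Local Open Scope ring_scope.

Local Notation borel_rV R d := (g_sigma_algebraType (@open 'rV[R]_d)).

(** * Euclidean pairing and norms on row vectors *)

Section Dot.
Context {R : realType} {d : nat}.
Implicit Types u v w : 'rV[R]_d.

Lemma dotDr u v w : dot u (v + w) = dot u v + dot u w.
Proof. by rewrite /dot -big_split /=; apply: eq_bigr => i _; rewrite mxE mulrDr. Qed.

Lemma dotDl u v w : dot (u + v) w = dot u w + dot v w.
Proof. by rewrite /dot -big_split /=; apply: eq_bigr => i _; rewrite mxE mulrDl. Qed.

Lemma dotZr a u v : dot u (a *: v) = a * dot u v.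
Proof. by rewrite /dot mulr_sumr; apply: eq_bigr => i _; rewrite mxE; ring. Qed.

Lemma dotNr u v : dot u (- v) = - dot u v.
Proof. by rewrite -scaleN1r dotZr mulN1r. Qed.

Lemma dotNl u v : dot (- u) v = - dot u v.
Proof. by rewrite /dot -sumrN; apply: eq_bigr => i _; rewrite mxE mulNr. Qed.

Lemma dotBr u v w : dot u (v - w) = dot u v - dot u w.
Proof. by rewrite dotDr dotNr. Qed.

Lemma dotBl u v w : dot (u - v) w = dot u w - dot v w.
Proof. by rewrite dotDl dotNl. Qed.

Lemma dot0r u : dot u 0 = 0.
Proof. by rewrite -(scale0r 0) dotZr mul0r. Qed.

Lemma dot0l u : dot 0 u = 0.
Proof. by rewrite /dot big1 // => i _; rewrite mxE mul0r. Qed.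

Lemma normr_coord u i : `|u 0 i| <= `|u|.
Proof.
rewrite [leRHS]/Num.norm /= mx_normrE.
by apply/bigmax_geP; right; exists (0, i).
Qed.

Lemma normr_dot u v : `|dot u v| <= d%:R * (`|u| * `|v|).
Proof.
rewrite /dot (le_trans (ler_norm_sum _ _ _))//.
have -> : d%:R * (`|u| * `|v|) = \sum_(i < d) `|u| * `|v|.
  by rewrite sumr_const card_ord mulr_natl.
by rewrite ler_sum// => i _; rewrite normrM ler_pM ?normr_coord.
Qed.

End Dot.

Lemma norm_lt_coord (R : realType) (d : nat) (u : 'rV[R]_d) e : 0 < e ->
  (forall i, `|u 0 i| < e) -> `|u| < e.
Proof.
move=> e0 h; rewrite /Num.norm /= mx_normrE; apply/bigmax_ltP; split => //.
by move=> [i j] _ /=; rewrite (ord1 i).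
Qed.

Lemma exists_invSn_lt (R : realType) (e : R) : 0 < e -> exists n, n.+1%:R^-1 < e.
Proof.
move=> e0; have [n _ h] := near_infty_natSinv_lt (PosNum e0).
by exists n; apply: h => /=.
Qed.

(** Each pair of a rational vector and a tolerance selects one point of [A] that fits it, if there
    is one. As [c] may be any finite family of real functions, the value of [r] can later serve as
    an extra coordinate. *)
Lemma countable_dense_coordinates (R : realType) (T : Type) (I : finType)
    (c : I -> T -> R) (A : set T) (x0 : T) : A x0 ->
  exists D : nat -> T, (forall n, A (D n)) /\
    forall u e, A u -> 0 < e -> exists n, forall i, `|c i (D n) - c i u| < e.
Proof.
move=> Ax0.
pose P (p : {ffun I -> rat} * nat) x :=
  A x /\ forall i, `|c i x - ratr (p.1 i)| < p.2.+1%:R^-1.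
(* Codes of no pair, and pairs that no point of [A] fits, default to [x0]. *)
pose D n := if unpickle n is Some p then
   if pselect (exists x, P p x) is left h then sval (cid h) else x0 else x0.
exists D; split.
  move=> n; rewrite /D; case: unpickle => [p|//]; case: pselect => // h.
  by have [] := svalP (cid h).
move=> u e Au e0.
have e20 : 0 < e / 2 by rewrite divr_gt0.
have [n hn] := exists_invSn_lt e20.
have n0 : (0 : R) < n.+1%:R^-1 by rewrite invr_gt0.
have /choice[q hq] : forall i, exists q : rat, `|c i u - ratr q| < n.+1%:R^-1.
  move=> i; have : c i u - n.+1%:R^-1 < c i u + n.+1%:R^-1 by rewrite ltrD2l gtrN.
  move=> /rat_in_itvoo[q]; rewrite in_itv /= => /andP[h1 h2].
  exists q; move: h1 h2; move: (_^-1) => k h1 h2.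
  by rewrite ltr_norml; apply/andP; split; lra.
exists (pickle ([ffun i => q i], n)) => i; rewrite /D pickleK.
case: pselect => [h|]; last first.
  by case; exists u; split => // j; rewrite ffunE.
have [_ /(_ i)] := svalP (cid h); rewrite /= ffunE.
move: (hq i) hn; move: (_^-1) => k; rewrite !ltr_norml => /andP[? ?] ? /andP[? ?].
by apply/andP; split; lra.
Qed.

Lemma lipschitz_continuous (R : realType) (V W : normedModType R) (f : V -> W) (C : R) :
  (forall x y, `|f x - f y| <= C * `|x - y|) -> continuous f.
Proof.
move=> fC x; apply/cvgrPdist_le => e e0.
have M0 : 0 < `|C| + 1 by rewrite ltr_wpDl.
apply/nbhs_normP; exists (e / (`|C| + 1)) => /=; first by rewrite divr_gt0.
move=> y /=; rewrite ltr_pdivlMr// => xy; apply: le_trans (fC _ _) _.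
apply: le_trans (ltW xy); rewrite mulrC ler_wpM2l//.
by rewrite (le_trans (ler_norm _))// lerDl.
Qed.

(** Bounded by a multiple of the sup norm, [N] is continuous and attains its minimum on the unit
    sphere; definiteness makes that minimum positive, and homogeneity extends the bound to all
    vectors. *)
Lemma norm_equivalence (R : realType) (d : nat) (N : 'rV[R]_d -> R) : is_norm N ->
  exists2 C, 0 < C & forall u, `|u| <= C * N u.
Proof.
move=> [tri hom def].
have N0 : N 0 = 0 by rewrite -(scale0r 0) hom normr0 mul0r.
have Nopp u : N (- u) = N u by rewrite -scaleN1r hom normrN1 mul1r.
have Nge0 u : 0 <= N u by have := tri u (- u); rewrite subrr N0 Nopp; lra.
pose B := \sum_(i < d) N (delta_mx 0 i).
have NB u : N u <= B * `|u|.
  rewrite {1}(row_sum_delta u) /B mulr_suml.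
  elim/big_ind2: _ => [|x1 x2 y1 y2 h1 h2|i _]; first by rewrite N0.
    by apply: le_trans (tri _ _) _; exact: lerD.
  by rewrite hom mulrC ler_wpM2l// normr_coord.
have B0 : 0 <= B by apply: sumr_ge0.
have Nc : continuous N.
  apply: (lipschitz_continuous (C := B)) => x y.
  have h1 := tri (x - y) y; have h2 := tri (y - x) x.
  move: h1 h2 (NB (x - y)); rewrite !subrK -[y - x]opprB Nopp ler_norml.
  by move=> *; apply/andP; split; lra.
pose S := [set u : 'rV[R]_d | `|u| = 1].
have cS : compact S.
  apply: bounded_closed_compact.
    by exists 1; split => // M M1 u /= ->; exact: ltW.
  have -> : S = (fun u => `|u|) @^-1` [set 1] by [].
  apply: preimage_closed => [x _|]; last exact: closed_eq.
  exact: norm_continuous.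
(* If the sphere is empty, the only vector is 0 and any constant works. *)
have [S0|] := pselect (S !=set0); last first.
  move=> S0; exists 1 => // u; rewrite mul1r.
  have [->|u0] := eqVneq u 0; first by rewrite normr0.
  case: S0; exists (`|u|^-1 *: u); rewrite /S /= normrZ ger0_norm ?invr_ge0//.
  by rewrite mulVf// normr_eq0.
have [x Sx hx] := EVT_min_rV S0 cS (continuous_subspaceT Nc).
have {}Sx : `|x| = 1 by rewrite inE in Sx.
have Nx : 0 < N x.
  rewrite lt_neqAle Nge0 andbT eq_sym; apply/eqP => /def x0.
  by move/eqP: Sx; rewrite x0 normr0 eq_sym oner_eq0.
exists (N x)^-1; first by rewrite invr_gt0.
move=> u; have [->|u0] := eqVneq u 0; first by rewrite normr0 N0 mulr0.
have nu : 0 < `|u| by rewrite normr_gt0.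
have := hx (`|u|^-1 *: u); rewrite inE /S /= normrZ hom.
rewrite ger0_norm ?invr_ge0// mulVf ?gt_eqF// => /(_ erefl).
by rewrite ler_pdivlMl// => h; rewrite mulrC ler_pdivlMr.
Qed.

(** * Borel measurability from closed sublevel sets and from continuity *)

Section BorelMeasurability.
Context {R : realType} {d : nat}.
Implicit Types (Z : set 'rV[R]_d).

Lemma measurable_closed_rV (C : set (borel_rV R d)) :
  closed (C : set 'rV[R]_d) -> measurable C.
Proof.
move=> cC; rewrite -(setCK C); apply: measurableC; apply: sub_sigma_algebra.
exact: closed_openC.
Qed.

(** Open upper rays generate the Borel sets of the line, and the preimage of such a ray in [Z] is
    [Z] minus a closed set. *)
Lemma lsc_measurable Z (c : 'rV[R]_d -> R) :
  (forall y, closed (Z `&` [set x | c x <= y])) ->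
  measurable_fun (Z : set (borel_rV R d)) (c : borel_rV R d -> R).
Proof.
move=> h mZ; apply: (measurability _ (RGenOInfty.measurableE R)) => //.
move=> _ [_ [y ->] <-].
rewrite (_ : _ `&` _ = Z `\` (Z `&` [set x | c x <= y])).
  by apply: measurableD => //; exact: measurable_closed_rV.
apply/seteqP; split => x /=; rewrite in_itv /= andbT.
  by move=> [Zx yx]; split => // -[_]; rewrite leNgt yx.
by move=> [Zx nx]; split => //; rewrite ltNge; apply/negP => xy; apply: nx.
Qed.

Lemma within_continuous_measurable Z (c : 'rV[R]_d -> R) : closed Z ->
  {within Z, continuous c} ->
  measurable_fun (Z : set (borel_rV R d)) (c : borel_rV R d -> R).
Proof.
move=> cZ cc; apply: lsc_measurable => y.
have /closed_subspaceP[V cV VE] :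
    closed ([set x | c x <= y] : set (subspace Z)).
  have -> : [set x | c x <= y] = (c : subspace Z -> R) @^-1` [set t | t <= y] by [].
  apply: preimage_closed => [x _|]; last exact: closed_le.
  exact: cc.
by rewrite setIC -VE; exact: closedI.
Qed.

End BorelMeasurability.

Lemma within_continuousP (R : realType) (U V : normedModType R) (A : set U)
    (f : U -> V) : {within A, continuous f} <->
  forall x e, A x -> 0 < e ->
    exists2 dl, 0 < dl & forall y, A y -> `|y - x| < dl -> `|f y - f x| < e.
Proof.
rewrite subspace_continuousP; split=> [fc x e Ax e0|h x Ax].
  have /cvgrPdist_lt/(_ _ e0) := fc _ Ax.
  rewrite /= near_withinE => /nbhs_normP[dl /= dl0 h].
  exists dl => // y Ay yx; rewrite distrC; apply: h => //=.
  by rewrite distrC.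
apply/cvgrPdist_lt => e e0; rewrite /= near_withinE; apply/nbhs_normP.
have [dl dl0 hdl] := h _ _ Ax e0; exists dl => //= y.
by rewrite /ball_ /= distrC => xy Ay; rewrite distrC; exact: hdl.
Qed.

Lemma integral_probability_cst (R : realType) (dT : measure_display)
    (T : measurableType dT) (P : probability T R) (c : R) :
  (\int[P]_x c%:E = c%:E)%E.
Proof.
have P1 : P setT = 1%E by exact: probability_setT.
by rewrite integral_cst// [X in (_ * X)%E]P1 mule1.
Qed.

(** * Seeds and independence *)

Section Independence.
Context {R : realType} {dO dS : measure_display}.
Context {Omega : measurableType dO} {S : measurableType dS}.
Variables (P : probability Omega R) (Q : probability S R).

Lemma independent_sigma (C : set (set Omega)) (x : {mfun Omega >-> S}) :
  C `<=` measurable -> setI_closed C -> C setT ->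
  (forall E B, C E -> measurable B -> P (E `&` x @^-1` B) = (P E * Q B)%E) ->
  forall E B, <<s C >> E -> measurable B -> P (E `&` x @^-1` B) = (P E * Q B)%E.
Proof.
move=> Cm CI CT H E B CE mB.
have mxB : measurable (x @^-1` B) by rewrite -[X in measurable X]setTI; exact: measurable_funP.
pose q : {nonneg R} := NngNum (fine_ge0 (measure_ge0 Q B)).
have qE : q%:num%:E = Q B by rewrite /= fineK// fin_num_measure.
have -> : P (E `&` x @^-1` B) = mrestr P mxB E by [].
rewrite muleC -qE -[RHS]/(mscale q P E).
apply: (g_sigma_algebra_measure_unique C Cm (fun=> setT)) => //.
- by rewrite bigcup_const//; exists 0%N.
- by move=> A CA; rewrite /mrestr /= /mscale /= fineK ?fin_num_measure// muleC; exact: H.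
- by move=> _; rewrite /= /mrestr setTI (le_lt_trans (probability_le1 P mxB))// ltry.
Qed.

(** By independence the joint law of [(y, x)] is the product of the law of [y] and [Q], so Tonelli
    integrates over the seed first, with [t] frozen. *)
Lemma expectation_independent dT (T : measurableType dT)
    (y : Omega -> T) (x : {mfun Omega >-> S}) (h : T * S -> \bar R) c :
  measurable_fun setT y ->
  (forall A B, measurable A -> measurable B ->
     P (y @^-1` A `&` x @^-1` B) = (P (y @^-1` A) * Q B)%E) ->
  measurable_fun setT h -> (forall p, 0 <= h p)%E ->
  (forall t, \int[Q]_s h (t, s) <= c%:E)%E ->
  (\int[P]_w h (y w, x w) <= c%:E)%E.
Proof.
move=> my yx mh h0 hc.
pose Y : {mfun Omega >-> T} := HB.pack y (isMeasurableFun.Build _ _ _ _ _ my).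
have mYX : measurable_fun setT (fun w => (y w, x w)) by exact: measurable_fun_pair.
pose YX : {mfun Omega >-> (T * S)%type} :=
  HB.pack (fun w => (y w, x w)) (isMeasurableFun.Build _ _ _ _ _ mYX).
have -> : (\int[P]_w h (y w, x w) = \int[pushforward P YX]_p h p)%E.
  by rewrite ge0_integral_pushforward.
pose L : probability T R := distribution P Y.
have -> : (\int[pushforward P YX]_p h p = \int[L \x Q]_p h p)%E.
  apply: eq_measure_integral => A mA _; apply/esym.
  by apply: (@product_measure_unique _ _ _ _ _ L Q (pushforward P YX)) => // B D mB mD; exact: yx.
rewrite fubini_tonelli1//.
apply: (@le_trans _ _ (\int[L]_t (cst c%:E) t)%E).
  apply: ge0_le_integral => //.
  - by move=> t _; apply: integral_ge0.
  - exact: measurable_fun_fubini_tonelli_F.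
  - by move=> t _; exact: hc.
by rewrite integral_probability_cst.
Qed.

Variables (K : nat) (xi : 'I_K -> {mfun Omega >-> S}).

Definition cylinder (J : {set 'I_K}) (A : 'I_K -> set S) : set Omega :=
  \bigcap_(i in [set` J]) xi i @^-1` A i.

(* A pi-system generating the sigma-algebra of the first [k] seeds. *)
Definition past (k : nat) : set (set Omega) :=
  [set E | exists2 A, (forall i, measurable (A i)) &
    E = cylinder [set i : 'I_K | (i < k)%N]%SET A].

Lemma measurable_cylinder J A : (forall i, measurable (A i)) -> measurable (cylinder J A).
Proof.
move=> mA; apply: fin_bigcap_measurable => // i _.
by rewrite -[X in measurable X]setTI; exact: measurable_funP.
Qed.

Lemma past_measurable k : past k `<=` measurable.
Proof. by move=> _ [A mA ->]; exact: measurable_cylinder. Qed.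

Lemma past_setI k : setI_closed (past k).
Proof.
move=> _ _ [A mA ->] [B mB ->]; exists (fun i => A i `&` B i).
  by move=> i; exact: measurableI.
by rewrite /cylinder -bigcapI.
Qed.

Lemma past_setT k : past k setT.
Proof. by exists (fun=> setT) => //; apply/seteqP; split. Qed.

Lemma past_succ k : past k `<=` past k.+1.
Proof.
move=> _ [A mA ->]; exists (fun i : 'I_K => if (i < k)%N then A i else setT).
  by move=> i; case: ifP.
apply/seteqP; split => w h i /=; rewrite inE => ik.
  by case: ifP => // ik'; apply: h => /=; rewrite inE.
by have := h i; rewrite /= inE ik; apply; exact: ltnW.
Qed.

Lemma past_xi (k : 'I_K) (B : set S) : measurable B -> past k.+1 (xi k @^-1` B).
Proof.
move=> mB; exists (fun i => if i == k then B else setT).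
  by move=> i; case: ifP.
apply/seteqP; split => w h.
  by move=> i _ /=; case: ifP => // /eqP ->.
by have := h k; rewrite /= inE ltnSn eqxx; exact.
Qed.

(** Intersecting a cylinder over the seeds before [k] with an event about seed [k] gives a cylinder
    over one more index; mutual independence factors both, and [independent_sigma] passes to the
    generated sigma-algebra. *)
Lemma past_independent (k : 'I_K) : mutually_independent P xi ->
  (forall k (A : set S), measurable A -> P (xi k @^-1` A) = Q A) ->
  forall E B, <<s past k >> E -> measurable B ->
    P (E `&` xi k @^-1` B) = (P E * Q B)%E.
Proof.
move=> hind hlaw; apply: independent_sigma; first exact: past_measurable.
- exact: past_setI.
- exact: past_setT.
move=> _ B [A mA ->] mB.
pose J := [set i : 'I_K | (i < k)%N]%SET.
pose A' i := if i == k then B else A i.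
have mA' i : measurable (A' i) by rewrite /A'; case: ifP.
have kJ : k \notin J by rewrite /J inE ltnn.
have A'E i : i \in J -> A' i = A i.
  by move=> iJ; rewrite /A'; case: eqP => // ik; rewrite ik (negbTE kJ) in iJ.
have -> : cylinder J A `&` xi k @^-1` B = cylinder (k |: J)%SET A'.
  apply/seteqP; split => w.
    move=> [h hk] i /=; rewrite in_setU1 => /orP[/eqP ->|iJ]; first by rewrite /A' eqxx.
    by rewrite A'E//; exact: h.
  move=> h; split; last by have := h k; rewrite /= setU11 /A' eqxx; exact.
  by move=> i /= iJ; rewrite -A'E//; apply: h => /=; rewrite setU1r.
have A'k : A' k = B by rewrite /A' eqxx.
rewrite /cylinder !hind// big_setU1//= A'k hlaw// muleC.
by congr (_ * _)%E; apply: eq_bigr => i iJ; rewrite A'E.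
Qed.

Lemma sigma_past_measurable k : <<s past k >> `<=` measurable.
Proof.
apply: smallest_sub; last exact: past_measurable.
exact: sigma_algebra_measurable.
Qed.

Lemma measurable_past k dT (T : measurableType dT) (y : Omega -> T) :
  measurable_fun setT (y : g_sigma_algebraType (past k) -> T) ->
  measurable_fun setT y.
Proof. by move=> my _ A mA; apply: sigma_past_measurable; exact: (my measurableT). Qed.

Lemma measurable_past_succ k dT (T : measurableType dT) (y : Omega -> T) :
  measurable_fun setT (y : g_sigma_algebraType (past k) -> T) ->
  measurable_fun setT (y : g_sigma_algebraType (past k.+1) -> T).
Proof.
move=> my _ A mA; have : <<s past k >> (setT `&` y @^-1` A) by exact: (my measurableT).
exact: sub_sigma_algebra2 (@past_succ k) _.
Qed.

Lemma measurable_xi_past (k : 'I_K) :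
  measurable_fun setT (xi k : g_sigma_algebraType (past k.+1) -> S).
Proof. by move=> _ B mB; rewrite setTI; apply: sub_sigma_algebra; exact: past_xi. Qed.

End Independence.

(** * Bregman geometry and the proximal step *)

Section RelativeGeometry.
Context {R : realType} {d : nat}.
Variables (N : 'rV[R]_d -> R) (Z : set 'rV[R]_d) (r : 'rV[R]_d -> R).
Variables (mu : R) (g : 'rV[R]_d -> 'rV[R]_d).
Hypothesis hN : is_norm N.
Hypothesis cZ : closed Z.
Hypothesis segZ : forall z u t, Z z -> Z u -> 0 <= t -> t <= 1 ->
  Z (z + t *: (u - z)).
Hypothesis hr : distance_generating N Z r.
Hypothesis mu0 : 0 < mu.
Hypothesis hgc : {within Z, continuous g}.
Hypothesis hgm : strongly_monotone_rel mu Z r g.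

(** The one-sided derivative of [r] at [z] towards [u], for points of [Z]. By [grad_pairingE],
    [fine] loses nothing there. *)
Definition slope z u : R := fine (grad_pairing Z r z (u - z)).
Definition breg z u : R := r u - r z - slope z u.

(** Without subgradients the pairing is [-oo], so the divergence from [z] to itself is [+oo],
    against strong monotonicity at the pair [z], [z]. *)
Lemma subdifferential_nonempty z : Z z -> exists q, subdifferential Z r z q.
Proof.
move=> Zz; apply: contrapT => /forallNP h.
have := hgm Zz Zz; rewrite /bregman /grad_pairing.
have -> : subdifferential Z r z = set0 by apply/seteqP; split => // q /h.
by rewrite image_set0 ereal_sup0 /= addey// gt0_muley ?lte_fin.
Qed.

Lemma grad_pairingE z u : Z z -> Z u -> grad_pairing Z r z (u - z) = (slope z u)%:E.
Proof.
move=> Zz Zu; rewrite /slope fineK// fin_numElt; apply/andP; split.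
  have [q hq] := subdifferential_nonempty Zz.
  by apply: (lt_le_trans (ltNyr (dot q (u - z)))); apply: ereal_sup_ubound; exists q.
apply: (@le_lt_trans _ _ (r u - r z)%:E); last exact: ltry.
apply: ge_ereal_sup => _ [q hq <-]; rewrite lee_fin.
by have := hq _ Zu; lra.
Qed.

Lemma bregmanE z u : Z z -> Z u -> bregman Z r z u = (breg z u)%:E.
Proof. by move=> Zz Zu; rewrite /bregman grad_pairingE. Qed.

Lemma dot_le_slope z u q : Z z -> Z u -> subdifferential Z r z q ->
  dot q (u - z) <= slope z u.
Proof.
move=> Zz Zu hq; rewrite -lee_fin -grad_pairingE//.
by apply: ereal_sup_ubound; exists q.
Qed.

Lemma slope_le z u c : Z z -> Z u ->
  (forall q, subdifferential Z r z q -> dot q (u - z) <= c) -> slope z u <= c.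
Proof.
move=> Zz Zu h; rewrite -lee_fin -grad_pairingE//.
by apply: ge_ereal_sup => _ [q hq <-]; rewrite lee_fin h.
Qed.

Lemma breg_ge_sqr z u : Z z -> Z u -> 2^-1 * N (u - z) ^+ 2 <= breg z u.
Proof.
move=> Zz Zu; have := hr Zz Zu.
by rewrite grad_pairingE// -!EFinD lee_fin /breg; lra.
Qed.

Lemma breg_ge0 z u : Z z -> Z u -> 0 <= breg z u.
Proof.
move=> Zz Zu; apply: le_trans (breg_ge_sqr Zz Zu).
by rewrite mulr_ge0// sqr_ge0.
Qed.

Lemma breg_le_dot z u : Z z -> Z u -> mu * breg z u <= dot (g z - g u) (z - u).
Proof. by move=> Zz Zu; have := hgm Zz Zu; rewrite bregmanE// -EFinM lee_fin. Qed.

Lemma slope_segment z u t : Z z -> Z u -> 0 <= t -> t <= 1 ->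
  slope z (z + t *: (u - z)) = t * slope z u.
Proof.
move=> Zz Zu t0 t1; have Zt := segZ Zz Zu t0 t1.
have E q : dot q (z + t *: (u - z) - z) = t * dot q (u - z).
  by rewrite addrAC subrr add0r dotZr.
apply/le_anti/andP; split.
  by apply: slope_le => // q hq; rewrite E ler_wpM2l// dot_le_slope.
have [->|tn0] := eqVneq t 0.
  rewrite mul0r; have [q hq] := subdifferential_nonempty Zz.
  apply: le_trans (dot_le_slope Zz _ hq); last by rewrite scale0r addr0.
  by rewrite scale0r addr0 subrr dot0r.
have tp : 0 < t by rewrite lt_neqAle eq_sym tn0.
rewrite mulrC -ler_pdivlMr//; apply: slope_le => // q hq.
by rewrite ler_pdivlMr// mulrC -E dot_le_slope.
Qed.

Lemma slope_refl z : Z z -> slope z z = 0.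
Proof.
move=> Zz; have := slope_segment Zz Zz (lexx 0) ler01.
by rewrite scale0r addr0 mul0r.
Qed.

Lemma continuous_along_segment z u w e : Z z -> Z u -> 0 < e ->
  exists2 dl, 0 < dl & forall t, 0 <= t -> t <= 1 -> t < dl ->
    `|dot (g (z + t *: (u - z)) - g z) w| <= e.
Proof.
move=> Zz Zu e0.
pose M := d%:R * `|w| + 1 : R.
have M0 : 0 < M by rewrite ltr_wpDl// mulr_ge0.
have eM0 : 0 < e / M by rewrite divr_gt0.
have [dl dl0 hdl] := (within_continuousP Z g).1 hgc _ _ Zz eM0.
pose L := `|u - z| + 1.
have L0 : 0 < L by rewrite ltr_wpDl.
exists (dl / L); first by rewrite divr_gt0.
move=> t t0 t1 tdl; have Zt := segZ Zz Zu t0 t1.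
rewrite (le_trans (normr_dot _ _))//.
have : `|g (z + t *: (u - z)) - g z| < e / M.
  apply: hdl => //; rewrite addrAC subrr add0r normrZ ger0_norm//.
  apply: (@le_lt_trans _ _ (t * L)); first by rewrite ler_wpM2l// lerDl.
  by rewrite -ltr_pdivlMr.
rewrite ltr_pdivlMr// => /ltW; apply: le_trans.
by rewrite mulrCA ler_wpM2l// lerDl.
Qed.

(** The upper counterpart of the subgradient inequality. Strong monotonicity bounds [mu] times the
    divergence from [z] to the chord point by [t] times the pairing of [u - z] with an increment of
    [g], and continuity makes that increment small. *)
Lemma radial_expansion z u e : Z z -> Z u -> 0 < e ->
  exists2 dl, 0 < dl & forall t, 0 <= t -> t <= 1 -> t < dl ->
    r (z + t *: (u - z)) <= r z + t * (slope z u + e).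
Proof.
move=> Zz Zu e0.
have [dl dl0 hdl] := continuous_along_segment (u - z) Zz Zu (mulr_gt0 mu0 e0).
exists dl => // t t0 t1 tdl; have Zt := segZ Zz Zu t0 t1.
have := breg_le_dot Zz Zt; rewrite /breg slope_segment//.
have -> : z - (z + t *: (u - z)) = t *: (z - u).
  by rewrite opprD addrA subrr add0r -scalerN opprB.
have -> : dot (g z - g (z + t *: (u - z))) (t *: (z - u)) =
          t * dot (g (z + t *: (u - z)) - g z) (u - z).
  by rewrite dotZr -[z - u]opprB dotNr -dotNl opprB.
have := hdl _ t0 t1 tdl; rewrite ler_norml => /andP[_ h].
move=> /le_trans /(_ (ler_wpM2l t0 h)); rewrite mulrCA ler_pM2l//; lra.
Qed.

Lemma slope_segment_le z u t : Z z -> Z u -> 0 <= t -> t <= 1 ->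
  t * slope z u <= r (z + t *: (u - z)) - r z.
Proof.
move=> Zz Zu t0 t1; rewrite -slope_segment//.
by have := breg_ge0 Zz (segZ Zz Zu t0 t1); rewrite /breg; lra.
Qed.

(* The convexity defect of [r] on a short chord near [z] is bounded by a
   Bregman divergence, hence is of second order by continuity of [g]; this
   makes the directional derivative at [z] affine even though [r] is not
   assumed differentiable. *)
Lemma slope_concave z u v l : Z z -> Z u -> Z v -> 0 <= l -> l <= 1 ->
  (1 - l) * slope z u + l * slope z v <= slope z (u + l *: (v - u)).
Proof.
move=> Zz Zu Zv l0 l1; have Zc := segZ Zu Zv l0 l1.
apply/ler_addgt0Pr => e e0.
have e20 : 0 < e / 2 by rewrite divr_gt0.
have e40 : 0 < mu * (e / 4) by rewrite mulr_gt0 ?divr_gt0.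
have [d1 d10 h1] := radial_expansion Zz Zc e20.
have [d2 d20 h2] := continuous_along_segment (u - v) Zz Zu e40.
have [d3 d30 h3] := continuous_along_segment (u - v) Zz Zv e40.
(* One step length below all three thresholds; halving makes the comparison strict. *)
pose t := Num.min 1 (Num.min d1 (Num.min d2 d3) / 2).
have m0 : 0 < Num.min d1 (Num.min d2 d3) by rewrite !lt_min d10 d20 d30.
have t0 : 0 < t by rewrite lt_min ltr01 divr_gt0.
have t1 : t <= 1 by rewrite ge_min lexx.
have : t < Num.min d1 (Num.min d2 d3).
  by rewrite gt_min; apply/orP; right; rewrite ltr_pdivrMr// ltr_pMr// ltr1n.
rewrite !lt_min => /and3P[td1 td2 td3].
have {}h1 := h1 _ (ltW t0) t1 td1.
have {}h2 := h2 _ (ltW t0) t1 td2.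
have {}h3 := h3 _ (ltW t0) t1 td3.
have ru := slope_segment_le Zz Zu (ltW t0) t1.
have rv := slope_segment_le Zz Zv (ltW t0) t1.
have Zut := segZ Zz Zu (ltW t0) t1.
have Zvt := segZ Zz Zv (ltW t0) t1.
set ut := z + t *: (u - z) in h2 ru Zut *.
set vt := z + t *: (v - z) in h3 rv Zvt *.
(* Scaling towards [z] commutes with convex combinations, so the chord from [ut] to [vt] meets the
   segment from [z] to the combined point. *)
have ctE : z + t *: (u + l *: (v - u) - z) = ut + l *: (vt - ut).
  by apply/rowP => i; rewrite /ut /vt !mxE; ring.
have {}ctE : r (ut + l *: (vt - ut)) <= r z + t * (slope z (u + l *: (v - u)) + e / 2).
  by rewrite -ctE.
(* Based at [ut], this yields [(1 - l) * r ut + l * r vt <= r (ut + l *: (vt - ut)) + l * breg ut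
   vt]; the next steps bound the last divergence by [t * (e / 2)]. *)
have := slope_segment_le Zut Zvt l0 l1.
have := breg_le_dot Zut Zvt.
have -> : ut - vt = t *: (u - v).
  by apply/rowP => i; rewrite /ut /vt !mxE; ring.
have -> : g ut - g vt = (g ut - g z) - (g vt - g z).
  by rewrite opprB addrA subrK.
rewrite dotBl !dotZr.
move: h2 h3; rewrite !ler_norml => /andP[_ h2] /andP[h3 _].
have {h2 h3} h : dot (g ut - g z) (u - v) - dot (g vt - g z) (u - v) <= mu * (e / 2).
  by lra.
rewrite -mulrBr => /le_trans /(_ (ler_wpM2l (ltW t0) h)).
rewrite mulrCA ler_pM2l// => hV hs.
have : l * breg ut vt <= t * (e / 2).
  apply: le_trans hV; rewrite ler_piMl// breg_ge0//.
move=> hl; rewrite -(ler_pM2l t0); move: ru rv ctE hs hl; rewrite /breg => ru rv rc hs hl.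
have := ler_wpM2l l0 rv.
have : (1 - l) * (t * slope z u) <= (1 - l) * (r ut - r z) by rewrite ler_wpM2l// subr_ge0.
lra.
Qed.

(** * The proximal step *)

Definition prox_objective p al be a b u : R :=
  dot p u + al * breg a u + be * breg b u.

(** The minimizer [c] is compared with [c + t *: (u - c)] for small [t]. There [r] is bounded above
    by [radial_expansion]; the slopes at [a] and [b] enter with a minus sign, so [slope_concave] is
    the right direction. Dividing by [t] leaves the error [e]. *)
Lemma prox_three_point p al be a b c u : 0 <= al -> 0 <= be -> 0 < al + be ->
  Z a -> Z b -> Z c ->
  (forall v, Z v -> prox_objective p al be a b c <= prox_objective p al be a b v) ->
  Z u ->
  prox_objective p al be a b c + (al + be) * breg c u <= prox_objective p al be a b u.
Proof.
move=> al0 be0 s0 Za Zb Zc hc Zu.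
apply/ler_addgt0Pr => e e0.
have es0 : 0 < e / (al + be) by rewrite divr_gt0.
have [dl dl0 hdl] := radial_expansion Zc Zu es0.
pose t := Num.min 1 (dl / 2).
have t0 : 0 < t by rewrite lt_min ltr01 divr_gt0.
have t1 : t <= 1 by rewrite ge_min lexx.
have tdl : t < dl.
  by rewrite gt_min; apply/orP; right; rewrite ltr_pdivrMr// ltr_pMr// ltr1n.
have {}hdl := hdl _ (ltW t0) t1 tdl.
have ha := slope_concave Za Zc Zu (ltW t0) t1.
have hb := slope_concave Zb Zc Zu (ltW t0) t1.
have := hc _ (segZ Zc Zu (ltW t0) t1).
rewrite /prox_objective /breg dotDr dotZr dotBr => H.
have := ler_wpM2l al0 ha; have := ler_wpM2l be0 hb.
have := ler_wpM2l (ltW s0) hdl.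
have -> : (al + be) * (r c + t * (slope c u + e / (al + be))) =
  (al + be) * (r c + t * slope c u) + t * e by field; rewrite gt_eqF.
move=> h1 h2 h3.
have : 0 <= t * (dot p u - dot p c + (al + be) * slope c u + e
   + al * (slope a c - slope a u) + be * (slope b c - slope b u)) by nra.
by rewrite pmulr_rge0//; lra.
Qed.

(** In the three-point inequality at [zs], strong monotonicity and the variational inequality bound
    [mu * breg b zs] by [dot (g b) (b - zs)]. Dropping [mu * breg b c] leaves the oracle bound
    tested at [u = c]. *)
Lemma prox_step al zs a b c e : 0 <= al ->
  VI_solution Z g zs -> Z a -> Z b -> Z c ->
  (forall v, Z v -> prox_objective (g b) al mu a b c <= prox_objective (g b) al mu a b v) ->
  (forall u, Z u -> dot (g b) (b - u) - al * breg a u <= e) ->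
  (al + mu) * breg c zs <= al * breg a zs + e.
Proof.
move=> al0 [Zzs hzs] Za Zb Zc hc he.
have := prox_three_point al0 (ltW mu0) (ltr_wpDl al0 mu0) Za Zb Zc hc Zzs.
have hb : dot (g zs) (zs - b) <= 0.
  rewrite -lee_fin; by apply: le_trans hzs; apply: ereal_sup_ubound; exists b.
have := breg_le_dot Zb Zzs; have := he _ Zc.
have := mulr_ge0 (ltW mu0) (breg_ge0 Zb Zc).
move: hb; rewrite /prox_objective dotBl !dotBr; lra.
Qed.

(** * Semicontinuity and measurability of the data *)

Lemma lower_tangent z : Z z -> exists2 M, 0 <= M &
  forall v, Z v -> r z - M * `|v - z| <= r v.
Proof.
move=> Zz; have [q hq] := subdifferential_nonempty Zz.
exists (d%:R * `|q|); first by rewrite mulr_ge0.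
move=> v Zv; have := hq _ Zv; have := normr_dot q (v - z).
by rewrite ler_norml mulrA => /andP[? _]; lra.
Qed.

(** A subgradient at the limit point keeps nearby values of [r] above its value there, up to a
    multiple of the distance. *)
Lemma closed_sublevel y : closed (Z `&` [set x | r x <= y]).
Proof.
move=> x hx; have Zx : Z x.
  by apply: cZ => B /hx [v [[Zv _] Bv]]; exists v.
split => //=; have [M M0 hM] := lower_tangent Zx.
apply/ler_addgt0Pr => e e0.
have M1 : 0 < M + 1 by rewrite ltr_wpDl.
have [v [[Zv /= rv]]] := hx _ (nbhsx_ballx x _ (divr_gt0 e0 M1)).
rewrite -ball_normE /ball_ /= ltr_pdivlMr// distrC => xv.
have := hM _ Zv; have : M * `|v - x| <= `|v - x| * (M + 1).
  by rewrite mulrC ler_wpM2l// lerDl.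
lra.
Qed.

Lemma measurable_dgf :
  measurable_fun (Z : set (borel_rV R d)) (r : borel_rV R d -> R).
Proof. exact: lsc_measurable closed_sublevel. Qed.

(** The slope is the limit of the difference quotients with step [n.+1%:R^-1], each built from [r]
    and its composition with a contraction towards [u]. *)
Lemma measurable_slope u : Z u ->
  measurable_fun (Z : set (borel_rV R d)) ((slope ^~ u) : borel_rV R d -> R).
Proof.
move=> Zu.
pose t n : R := n.+1%:R^-1.
have t0 n : 0 < t n by rewrite invr_gt0.
have t1 n : t n <= 1 by rewrite invf_le1// ler1n.
apply: (@measurable_fun_cvg _ _ _ _
  (fun n (a : borel_rV R d) => n.+1%:R * (r (a + t n *: (u - a)) - r a))).
  move=> n; apply: measurable_funM => //; apply: measurable_funB; last exact: measurable_dgf.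
  apply: lsc_measurable => y.
  pose phi (a : 'rV[R]_d) := a + t n *: (u - a).
  (* By convexity [phi] maps [Z] into itself, so [Z] may be inserted under the preimage, where
     [closed_sublevel] applies. *)
  rewrite (_ : _ `&` _ = Z `&` phi @^-1` (Z `&` [set x | r x <= y])).
    apply: closedI => //; apply: preimage_closed; last exact: closed_sublevel.
    move=> x _; apply: (lipschitz_continuous (C := 1 - t n)) => {}x x'.
    have -> : phi x - phi x' = (1 - t n) *: (x - x').
      by apply/rowP => i; rewrite !mxE; ring.
    by rewrite normrZ ger0_norm// subr_ge0.
  apply/seteqP; split => a /= [Za]; last by case.
  by move=> h; do 2 split => //; apply: segZ => //; exact: ltW.
move=> a Za; apply/cvgrPdist_le => e e0.
have [dl dl0 hdl] := radial_expansion Za Zu e0.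
have [n0 _ hn0] := near_infty_natSinv_lt (PosNum dl0).
exists n0 => // n /= n0n.
have := hdl _ (ltW (t0 n)) (t1 n) (hn0 _ n0n).
have := slope_segment_le Za Zu (ltW (t0 n)) (t1 n).
have -> : n.+1%:R = (t n)^-1 by rewrite invrK.
move: (t n) (t0 n) => s s0 h1 h2.
have {}h1 : slope a u <= s^-1 * (r (a + s *: (u - a)) - r a).
  by rewrite ler_pdivlMl.
have {}h2 : s^-1 * (r (a + s *: (u - a)) - r a) <= slope a u + e.
  by rewrite ler_pdivrMl//; lra.
by rewrite ler_norml; apply/andP; split; lra.
Qed.

(* Density in the graph of [r], rather than in its domain, because only lower
   semicontinuity of [r] is available. *)
Lemma dense_in_graph (A : set 'rV[R]_d) x0 : A x0 ->
  exists D : nat -> 'rV[R]_d, (forall n, A (D n)) /\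
    forall u e, A u -> 0 < e ->
      exists n, `|D n - u| < e /\ `|r (D n) - r u| < e.
Proof.
move=> Ax0.
pose c (i : option 'I_d) (u : 'rV[R]_d) := if i is Some j then u 0 j else r u.
have [D [DA hD]] := countable_dense_coordinates c Ax0.
exists D; split => // u e Au e0; have [n hn] := hD _ _ Au e0.
exists n; split; last exact: (hn None).
by apply: norm_lt_coord => // i; have := hn (Some i); rewrite !mxE.
Qed.

Lemma slope_lsc a u e : Z a -> Z u -> 0 < e ->
  exists2 dl, 0 < dl & forall v, Z v -> `|v - u| < dl ->
    slope a u - e <= slope a v.
Proof.
move=> Za Zu e0.
have [q hq hqu] : exists2 q, subdifferential Z r a q &
    slope a u - e / 2 < dot q (u - a).
  apply: contrapT => h; suff : slope a u <= slope a u - e / 2.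
    by lra.
  apply: slope_le => // q hq; rewrite leNgt; apply/negP => ?.
  by apply: h; exists q.
pose M := d%:R * `|q| + 1.
have M0 : 0 < M by rewrite ltr_wpDl// mulr_ge0.
exists (e / 2 / M); first by rewrite !divr_gt0.
move=> v Zv; rewrite ltr_pdivlMr// => vu.
have := dot_le_slope Za Zv hq.
have -> : v - a = (v - u) + (u - a) by rewrite addrA subrK.
rewrite dotDr; have := normr_dot q (v - u).
have : d%:R * (`|q| * `|v - u|) <= `|v - u| * M.
  by rewrite mulrA mulrC ler_wpM2l// lerDl.
by rewrite ler_norml => ? /andP[? _]; lra.
Qed.

(** The slopes enter with a minus sign, so their lower semicontinuity bounds the objective from
    above; [r] is controlled by closeness in the graph. *)
Lemma prox_objective_approx p al be a b u e : 0 <= al -> 0 <= be ->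
  Z a -> Z b -> Z u -> 0 < e ->
  exists2 dl, 0 < dl & forall v, Z v -> `|v - u| < dl -> `|r v - r u| < dl ->
    prox_objective p al be a b v <= prox_objective p al be a b u + e.
Proof.
move=> al0 be0 Za Zb Zu e0.
(* The summands pay for the linear term, for the two occurrences of [r] and for the two slopes; the
   final 1 makes [M] positive. *)
pose M := d%:R * `|p| + al + be + al + be + 1.
have M0 : 0 < M by rewrite ltr_wpDl// !addr_ge0// mulr_ge0.
have eM : 0 < e / M by rewrite divr_gt0.
have [d1 d10 h1] := slope_lsc Za Zu eM.
have [d2 d20 h2] := slope_lsc Zb Zu eM.
exists (Num.min (e / M) (Num.min d1 d2)); first by rewrite !lt_min eM d10 d20.
move=> v Zv; rewrite !lt_min => /and3P[vu1 vu2 vu3] /and3P[rv _ _].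
have {}h1 := ler_wpM2l al0 (h1 _ Zv vu2).
have {}h2 := ler_wpM2l be0 (h2 _ Zv vu3).
have hp : dot p v - dot p u <= d%:R * `|p| * (e / M).
  rewrite -dotBr (le_trans (ler_norm _))// (le_trans (normr_dot _ _))//.
  by rewrite mulrA ler_wpM2l// ?mulr_ge0// ltW.
have {}rv : r v <= r u + e / M by move: rv; rewrite ltr_norml; lra.
have ha := ler_wpM2l al0 rv; have hb := ler_wpM2l be0 rv.
have eE : e = e / M * (d%:R * `|p| + al + be + al + be + 1).
  by rewrite -/M divfK// gt_eqF.
rewrite /prox_objective /breg.
by move: eE hp h1 h2 ha hb (ltW eM); move: (e / M) (d%:R * `|p|) => E P *; lra.
Qed.

Lemma continuous_dotg u : {within Z, continuous (fun b => dot (g b) u)}.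
Proof.
apply/within_continuousP => x e Zx e0.
have M0 : 0 < d%:R * `|u| + 1 by rewrite ltr_wpDl// mulr_ge0.
have [dl dl0 h] := (within_continuousP Z g).1 hgc _ _ Zx (divr_gt0 e0 M0).
exists dl => // v Zv vx; rewrite -dotBl (le_lt_trans (normr_dot _ _))//.
have := h _ Zv vx; rewrite ltr_pdivlMr//; apply: le_lt_trans.
by rewrite mulrCA ler_wpM2l// lerDl.
Qed.

Lemma measurable_dotg_diag : measurable_fun (Z : set (borel_rV R d))
  ((fun b => dot (g b) b) : borel_rV R d -> R).
Proof.
have -> : (fun b => dot (g b) b) =
    (fun b => \sum_(i < d) dot (g b) (delta_mx 0 i) * b 0 i).
  apply/funext => b; apply: eq_bigr => i _; congr (_ * _).
  rewrite /dot (bigD1 i)//= mxE !eqxx mulr1 big1 ?addr0// => j ji.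
  by rewrite mxE (negbTE ji) andbF mulr0.
apply: measurable_sum => i; apply: measurable_funM.
  by apply: within_continuous_measurable => //; exact: continuous_dotg.
apply: within_continuous_measurable => //; apply: continuous_subspaceT.
exact: coord_continuous.
Qed.

Definition residual al a b : \bar R :=
  ereal_sup [set ((dot (g b) (b - u))%:E - al%:E * bregman Z r a u)%E | u in Z].

Section Composition.
Context {dT : measure_display} {T : measurableType dT}.
Implicit Types a b c : T -> 'rV[R]_d.

(** Values in [Z] are included because [r], its slopes and [g] are measurable on [Z] only. The
    sigma-algebra of [T] stays a parameter, so that the past of the seeds can be used. *)
Definition Zmeasurable a :=
  (forall w, Z (a w)) /\ measurable_fun [set: T] (a : T -> borel_rV R d).

Lemma measurable_comp_on a (f : 'rV[R]_d -> R) : Zmeasurable a ->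
  measurable_fun (Z : set (borel_rV R d)) (f : borel_rV R d -> R) ->
  measurable_fun [set: T] (f \o a).
Proof.
move=> [Za ma] mf; apply: (measurable_comp _ _ mf ma).
  exact: measurable_closed_rV.
by move=> _ [w _ <-]; exact: Za.
Qed.

Lemma measurable_breg a u : Zmeasurable a -> Z u ->
  measurable_fun [set: T] (fun w => breg (a w) u).
Proof.
move=> ha Zu; apply: measurable_funB; last exact: (measurable_comp_on ha (measurable_slope Zu)).
by apply: measurable_funB => //; exact: (measurable_comp_on ha measurable_dgf).
Qed.

Lemma measurable_prox_objective al be a b u : Zmeasurable a -> Zmeasurable b -> Z u ->
  measurable_fun [set: T] (fun w => prox_objective (g (b w)) al be (a w) (b w) u).
Proof.
move=> ha hb Zu.
apply: measurable_funD; last by apply: measurable_funM => //; exact: measurable_breg.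
apply: measurable_funD; last by apply: measurable_funM => //; exact: measurable_breg.
apply: (measurable_comp_on (f := fun x : 'rV[R]_d => dot (g x) u) hb).
apply: within_continuous_measurable => //.
exact: continuous_dotg.
Qed.

(* [c w] lies in a closed set [C] iff the infimum of the objective over a
   countable graph-dense subset of [Z `&` C] equals its minimum. *)
Lemma measurable_prox al be a b c : 0 <= al -> 0 < be ->
  Zmeasurable a -> Zmeasurable b -> (forall w, Z (c w)) ->
  (forall w v, Z v -> prox_objective (g (b w)) al be (a w) (b w) (c w)
                   <= prox_objective (g (b w)) al be (a w) (b w) v) ->
  Zmeasurable c.
Proof.
move=> al0 be0 ha hb Zc hc; split => //.
have [Za _] := ha; have [Zb _] := hb.
suff H C : closed C -> measurable (c @^-1` C).
  apply: (@measurability _ _ T (borel_rV R d) setT c (@open _) erefl).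
  move=> _ [U oU <-]; rewrite setTI.
  rewrite -(setCK U) preimage_setC; apply: measurableC.
  exact: (H _ (open_closedC oU)).
move=> cC.
have [[x0 Ax0]|A0] := pselect ((Z `&` C) !=set0); last first.
  rewrite (_ : _ @^-1` _ = set0)//; apply/seteqP; split => // w /= Cw.
  by apply: A0; exists (c w); split.
have [DA [DAA hDA]] := dense_in_graph Ax0.
have [DZ [DZZ hDZ]] := dense_in_graph Ax0.1.
pose F w u := prox_objective (g (b w)) al be (a w) (b w) u.
have approx w u e : Z u -> 0 < e -> exists2 dl, 0 < dl &
    forall v, Z v -> `|v - u| < dl -> `|r v - r u| < dl -> F w v <= F w u + e.
  move=> Zu e0; exact: (prox_objective_approx _ al0 (ltW be0) (Za w) (Zb w) Zu e0).
rewrite (_ : c @^-1` C = \bigcap_(k in setT) \bigcup_(j in setT)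
   \bigcap_(i in setT) [set w | F w (DA j) <= F w (DZ i) + k.+1%:R^-1]).
  apply: bigcap_measurableType => k _; apply: bigcupT_measurable => j.
  apply: bigcap_measurableType => i _.
  rewrite -[X in measurable X]setTI.
  apply: (measurable_fun_ler _ _ measurableT (Y := [set true])) => //.
    exact: measurable_prox_objective ha hb (DAA j).1.
  by apply: measurable_funD => //; exact: measurable_prox_objective ha hb (DZZ i).
apply/seteqP; split => w /=.
  move=> Cw k _.
  have k0 : (0 : R) < k.+1%:R^-1 by rewrite invr_gt0.
  have [dl dl0 hdl] := approx w (c w) _ (Zc w) k0.
  have [j [hj1 hj2]] := hDA (c w) dl (conj (Zc w) Cw) dl0.
  exists j => // i _ /=; apply: le_trans (hdl _ (DAA j).1 hj1 hj2) _.
  by rewrite lerD2r; exact: hc.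
(* Conversely, some [DA j] in [C] is nearly optimal; quadratic growth around the minimizer puts it
   within [e] of [c w], and [C] is closed. *)
move=> h; apply: cC => B /nbhs_ballP[e /= e0 eB].
have [M M0 hM] := norm_equivalence hN.
have s0 : 0 < al + be by rewrite ltr_wpDl.
(* Half of the growth forced at distance [e], with [M] converting between the norms: one half pays
   for [k.+1%:R^-1], the other for approximating [c w]. *)
have e'0 : 0 < (al + be) * (2^-1 * (e / M) ^+ 2) / 2.
  by rewrite !(mulr_gt0, divr_gt0, exprn_gt0, invr_gt0).
have [k hk] := exists_invSn_lt e'0.
have [j _ hj] := h k I.
exists (DA j); split; first exact: (DAA j).2.
apply: eB; rewrite -ball_normE /ball_ /= distrC.
have [dl dl0 hdl] := approx w (c w) _ (Zc w) e'0.
have [i [hi1 hi2]] := hDZ (c w) dl (Zc w) dl0.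
have {}hdl := hdl _ (DZZ i) hi1 hi2.
have {}hj : F w (DA j) <= F w (DZ i) + k.+1%:R^-1 := hj i I.
have := prox_three_point al0 (ltW be0) s0
   (Za w) (Zb w) (Zc w) (hc w) (DAA j).1.
rewrite -/(F w (c w)) -/(F w (DA j)) => h3.
have : (al + be) * breg (c w) (DA j) < (al + be) * (2^-1 * (e / M) ^+ 2).
  move: hk hdl hj; move: (_ * (_ * _)) (k.+1%:R^-1 : R) => X kk *; lra.
rewrite ltr_pM2l// => h4.
have h5 := le_lt_trans (breg_ge_sqr (Zc w) (DAA j).1) h4.
move: h5; rewrite ltr_pM2l ?invr_gt0// => h5.
apply: le_lt_trans (hM _) _; rewrite mulrC -ltr_pdivlMr//.
rewrite ltNge; apply/negP => h6; move: h5; rewrite ltNge => /negP; apply.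
by rewrite ler_pXn2r// nnegrE ?divr_ge0 ?(ltW e0) ?(ltW M0)// (le_trans _ h6)// divr_ge0 ?ltW.
Qed.

Lemma measurable_residual al a b : 0 <= al -> Zmeasurable a -> Zmeasurable b ->
  measurable_fun [set: T] (fun w => residual al (a w) (b w)).
Proof.
move=> al0 ha hb; have [Za _] := ha; have [Zb _] := hb.
have [D [DZ hD]] := dense_in_graph (Za point).
(* With weight 0 on the second divergence, the residual is the supremum of a constant minus a
   proximal objective, so a graph-dense sequence computes it. *)
pose t n w := dot (g (b w)) (b w) - prox_objective (g (b w)) al 0 (a w) (b w) (D n).
have mt n : measurable_fun [set: T] (t n).
  apply: measurable_funB; first exact: (measurable_comp_on hb measurable_dotg_diag).
  exact: measurable_prox_objective.
have -> : (fun w => residual al (a w) (b w)) =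
    (fun w => esups (fun n => (t n w)%:E) 0%N).
  apply/funext => w; apply/le_anti/andP; split.
    apply: ge_ereal_sup => _ [u Zu <-].
    rewrite bregmanE// -EFinM -EFinB.
    apply/lee_addgt0Pr => e e0.
    have [dl dl0 hdl] := prox_objective_approx (g (b w)) al0 (lexx 0) (Za w) (Zb w) Zu e0.
    have [n [h1 h2]] := hD _ _ Zu dl0.
    apply: (@le_trans _ _ ((t n w)%:E + e%:E)%E); last first.
      by rewrite leeD2r//; apply: ereal_sup_ubound; exists n.
    have := hdl _ (DZ n) h1 h2.
    by rewrite -EFinD lee_fin /t dotBr /prox_objective; lra.
  apply: ge_ereal_sup => _ [n _ <-]; apply: ereal_sup_ubound.
  exists (D n) => //; rewrite bregmanE// -EFinM -EFinB /t dotBr /prox_objective.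
  by congr EFin; ring.
by apply: measurable_fun_esups => n; apply/measurable_EFinP.
Qed.

End Composition.

(** Compactness bounds the pairing, and the divergence only lowers the value; testing [u = a], where
    the divergence vanishes, bounds it from below. Adding [C] later makes the integrands
    nonnegative. *)
Lemma residual_bounded al : compact Z -> 0 <= al -> exists2 C, 0 <= C &
  forall a b, Z a -> Z b -> exists2 h, residual al a b = h%:E & `|h| <= C.
Proof.
move=> kZ al0.
have [M1 [_ hM1]] := compact_bounded kZ.
have [M2 [_ hM2]] := compact_bounded (continuous_compact hgc kZ).
have {}hM1 u : Z u -> `|u| <= `|M1| + 1.
  by apply: hM1; rewrite (le_lt_trans (ler_norm _))// ltrDl.
have {}hM2 u : Z u -> `|g u| <= `|M2| + 1.
  by move=> Zu; apply: hM2; [rewrite (le_lt_trans (ler_norm _))// ltrDl|exists u].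
pose C := d%:R * ((`|M2| + 1) * (`|M1| + 1 + (`|M1| + 1))).
have hC b u : Z b -> Z u -> `|dot (g b) (b - u)| <= C.
  move=> Zb Zu; apply: le_trans (normr_dot _ _) _.
  rewrite ler_wpM2l// ler_pM// ?hM2//.
  by apply: le_trans (ler_normB _ _) _; rewrite lerD ?hM1.
exists C; first by rewrite !mulr_ge0// ?addr_ge0.
move=> a b Za Zb.
have h1 : (residual al a b <= C%:E)%E.
  apply: ge_ereal_sup => _ [u Zu <-]; rewrite bregmanE// -EFinM -EFinB lee_fin.
  have := hC _ _ Zb Zu; rewrite ler_norml => /andP[_].
  by have := mulr_ge0 al0 (breg_ge0 Za Zu); lra.
have h2 : ((- C)%:E <= residual al a b)%E.
  apply: (@le_trans _ _ ((dot (g b) (b - a))%:E - al%:E * bregman Z r a a)%E); last first.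
    by apply: ereal_sup_ubound; exists a.
  rewrite bregmanE// -EFinM -EFinB lee_fin /breg slope_refl// !subrr mulr0.
  by have := hC _ _ Zb Za; rewrite ler_norml => /andP[]; lra.
move: h1 h2; case: (residual al a b) => [h| |]//; rewrite !lee_fin => h1 h2.
by exists h => //; rewrite ler_norml h1 h2.
Qed.

Lemma dot_le_residual al a b u h : Z a -> Z u -> residual al a b = h%:E ->
  dot (g b) (b - u) - al * breg a u <= h.
Proof.
move=> Za Zu hh; rewrite -lee_fin -hh; apply: ereal_sup_ubound.
by exists u => //; rewrite bregmanE// -EFinM -EFinB.
Qed.

(** * Expected decay of the divergence *)

Section ExpectedDecay.
Context {dO dS : measure_display} {Omega : measurableType dO} {S : measurableType dS}.
Variables (P : probability Omega R) (Q : probability S R).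
Variables (al eps : R) (O : 'rV[R]_d -> S -> 'rV[R]_d).
Hypothesis kZ : compact Z.
Hypothesis al0 : 0 < al.
Hypothesis hO : relaxed_proximal_oracle Z r g al eps Q O.

Lemma Zmeasurable_oracle dT (T : measurableType dT) (a : T -> 'rV[R]_d) (x : T -> S) :
  Zmeasurable a -> measurable_fun setT x -> Zmeasurable (fun w => O (a w) (x w)).
Proof.
move=> [Za ma] mx; have [mO ZO _] := hO; split; first by move=> w; exact: ZO.
apply: (measurable_comp (F := (Z : set (borel_rV R d)) `*` [set: S]) _ _ mO
  (measurable_fun_pair ma mx)).
  by apply: measurableX => //; exact: measurable_closed_rV.
by move=> _ [w _ <-]; split => //=; exact: Za.
Qed.

(* Used to extend maps that are only measurable on [Z]. *)
Definition retract z0 z : 'rV[R]_d := if z \in Z then z else z0.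

Lemma Zmeasurable_retract z0 : Z z0 ->
  Zmeasurable (retract z0 : borel_rV R d -> 'rV[R]_d).
Proof.
move=> Zz0; split=> [w|]; first by rewrite /retract; case: ifP => // /set_mem.
have mZ : measurable (Z : set (borel_rV R d)) by exact: measurable_closed_rV.
apply: (@measurable_fun_ifT _ _ (borel_rV R d) (borel_rV R d) id (cst z0)
  (fun z => z \in Z)) => //.
apply: (measurable_fun_bool true) => //; rewrite setTI.
by rewrite (_ : _ @^-1` _ = Z)//; apply/seteqP; split => u; [exact: set_mem|exact: mem_set].
Qed.

(** For a frozen query the oracle bounds the mean residual; independence of [a] and the seed carries
    this over to a random query. *)
Lemma expected_residual (a : Omega -> 'rV[R]_d) (x : {mfun Omega >-> S}) C :
  Zmeasurable a -> 0 <= C ->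
  (forall a b, Z a -> Z b -> exists2 h, residual al a b = h%:E & `|h| <= C) ->
  (forall (A : set (borel_rV R d)) B, measurable A -> measurable B ->
     P (a @^-1` A `&` x @^-1` B) = (P (a @^-1` A) * Q B)%E) ->
  (\int[P]_w (residual al (a w) (O (a w) (x w)) + C%:E) <= (eps + C)%:E)%E.
Proof.
move=> ha C0 hC hind; have [Za ma] := ha; have [_ ZO hOe] := hO.
pose z0 := a point.
have Zr := Zmeasurable_retract (Za point : Z z0).
pose h (p : borel_rV R d * S) :=
  (residual al (retract z0 p.1) (O (retract z0 p.1) p.2) + C%:E)%E.
have -> : (\int[P]_w (residual al (a w) (O (a w) (x w)) + C%:E) =
           \int[P]_w h (a w, x w))%E.
  by apply: eq_integral => w _; rewrite /h /= /retract mem_set.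
have h0 p : (0 <= h p)%E.
  have Zp := Zr.1 p.1.
  have [k kE] := hC _ _ Zp (ZO _ p.2 Zp).
  by rewrite /h kE -EFinD lee_fin ler_norml => /andP[]; lra.
apply: (expectation_independent _ hind) => //.
  have hr1 : Zmeasurable (fun p : borel_rV R d * S => retract z0 p.1).
    split=> [p|]; first exact: Zr.1.
    exact: (measurableT_comp Zr.2 measurable_fst).
  apply: emeasurable_funD => //; apply: measurable_residual => //; first exact: ltW.
  by apply: Zmeasurable_oracle => //; exact: measurable_snd.
move=> t; have Zt := Zr.1 t.
have mres : measurable_fun [set: S]
    (fun s => residual al (retract z0 t) (O (retract z0 t) s)).
  have hc : Zmeasurable (fun _ : S => retract z0 t) by split => //; exact: measurable_cst.
  apply: measurable_residual => //; first exact: ltW.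
  by apply: Zmeasurable_oracle => //; exact: measurable_id.
pose f s := fine (residual al (retract z0 t) (O (retract z0 t) s)).
have fE s : residual al (retract z0 t) (O (retract z0 t) s) = (f s)%:E.
  by rewrite /f; have [k -> _] := hC _ _ Zt (ZO _ s Zt).
(* The residual has no fixed sign, so integrability is required to split off the constant [C]. *)
have intf : Q.-integrable [set: S] (EFin \o f).
  apply: measurable_bounded_integrable => //.
  - by rewrite (le_lt_trans (probability_le1 Q _))// ltry.
  - by apply/measurable_EFinP; rewrite (_ : EFin \o f = fun s =>
      residual al (retract z0 t) (O (retract z0 t) s))//; apply/funext => s; rewrite fE.
  - exists C; split; first exact: num_real.
    move=> M CM s _; apply: le_trans (ltW CM).
    by rewrite /f; have [k -> ?] := hC _ _ Zt (ZO _ s Zt).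
rewrite /h /=; under eq_integral do rewrite fE.
rewrite integralD//; last first.
  exact: (finite_measure_integrable_cst Q C).
rewrite integral_probability_cst EFinD leeD2r//.
rewrite (le_trans _ (hOe _ Zt))//.
by under eq_integral do rewrite /= -fE.
Qed.

Variables (zs : 'rV[R]_d) (K : nat) (xi : 'I_K -> {mfun Omega >-> S}).
Hypothesis hzs : VI_solution Z g zs.
Hypothesis hxi_law : forall k (A : set S), measurable A -> P (xi k @^-1` A) = Q A.
Hypothesis hxi_ind : mutually_independent P xi.
Variables z zh : nat -> Omega -> 'rV[R]_d.
Hypothesis hz0 : forall w, is_argmin Z (EFin \o r) (z 0%N w).
Hypothesis hzh : forall (k : 'I_K) w, zh k w = O (z k w) (xi k w).
Hypothesis hz : forall (k : 'I_K) w, is_argmin Z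
  (fun u => (dot (g (zh k w)) u)%:E + al%:E * bregman Z r (z k w) u
            + mu%:E * bregman Z r (zh k w) u)%E (z k.+1 w).

Lemma slope_argmin_ge0 a u : is_argmin Z (EFin \o r) a -> Z u -> 0 <= slope a u.
Proof.
move=> [Za ha] Zu; have h0 : subdifferential Z r a 0.
  by move=> v Zv; rewrite dot0l addr0 -lee_fin; exact: ha.
by have := dot_le_slope Za Zu h0; rewrite dot0l.
Qed.

(** Slopes at a minimizer are nonnegative, so strong convexity separates the values of [r] at
    distinct points. Hence the initial iterate is constant in [w]. *)
Lemma argmin_unique a b : is_argmin Z (EFin \o r) a -> is_argmin Z (EFin \o r) b -> a = b.
Proof.
move=> ha hb; have [Za _] := ha; have [Zb mb] := hb.
have := mb _ Za; rewrite /= lee_fin => rba.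
have := breg_ge_sqr Za Zb; have := slope_argmin_ge0 ha Zb; rewrite /breg => h1 h2.
have : N (b - a) ^+ 2 <= 0.
  have -> : N (b - a) ^+ 2 = 2 * (2^-1 * N (b - a) ^+ 2) by field.
  by rewrite pmulr_rle0//; lra.
rewrite le_eqVlt ltNge sqr_ge0 orbF sqrf_eq0 => /eqP.
by have [_ _ def] := hN; move=> /def /eqP; rewrite subr_eq0 => /eqP ->.
Qed.

Lemma prox_objective_argmin (k : 'I_K) w v : Z (z k w) -> Z v ->
  prox_objective (g (zh k w)) al mu (z k w) (zh k w) (z k.+1 w)
  <= prox_objective (g (zh k w)) al mu (z k w) (zh k w) v.
Proof.
move=> Zk Zv; have [Zk1 h] := hz k w; have [_ ZO _] := hO.
have Zh : Z (zh k w) by rewrite hzh; exact: ZO.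
by have := h _ Zv; rewrite !bregmanE// -!EFinM -!EFinD lee_fin.
Qed.

(** Adaptedness: iterate [k] depends only on the seeds before index [k], which makes it independent
    of seed [k]. *)
Lemma Zmeasurable_iterate k : (k <= K)%N ->
  @Zmeasurable _ (g_sigma_algebraType (past xi k)) (z k).
Proof.
elim: k => [_|k IH kK].
  split=> [w|]; first by have [] := hz0 w.
  rewrite (_ : z 0%N = cst (z 0%N point)); first exact: measurable_cst.
  by apply/funext => w; exact: argmin_unique (hz0 w) (hz0 point).
have [Zk mk] := IH (ltnW kK).
pose i := Ordinal kK.
have hk : @Zmeasurable _ (g_sigma_algebraType (past xi k.+1)) (z k).
  by split => //; exact: measurable_past_succ.
have hh : @Zmeasurable _ (g_sigma_algebraType (past xi k.+1)) (zh k).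
  rewrite (_ : zh k = fun w => O (z k w) (xi i w)).
    by apply: Zmeasurable_oracle => //; exact: (measurable_xi_past (k := i)).
  by apply/funext => w; have := hzh i w.
apply: (measurable_prox (ltW al0) mu0 hk hh) => [w|w v Zv].
  by have [] := hz i w.
exact: (@prox_objective_argmin i).
Qed.

(** Integrating [prox_step] gives an affine recursion with fixed point [eps / mu], since [al * (eps
    / mu) + eps = (al + mu) * (eps / mu)]; the deviation contracts by [al / (mu + al)]. *)
Lemma expected_breg_decay Theta k : (k <= K)%N ->
  (forall u v, Z u -> Z v -> r u - r v <= Theta) -> 0 <= eps ->
  (\int[P]_w (breg (z k w) zs)%:E
     <= ((al / (mu + al)) ^+ k * Theta + eps / mu)%:E)%E.
Proof.
move=> kK hTheta eps0; have Zzs := hzs.1.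
have mz k' : (k' <= K)%N -> Zmeasurable (z k').
  move=> /Zmeasurable_iterate[? mk]; split => //; exact: measurable_past mk.
have mV k' : (k' <= K)%N -> measurable_fun setT (fun w => (breg (z k' w) zs)%:E).
  by move=> /mz ?; apply/measurable_EFinP; exact: measurable_breg.
have V0 k' w : (k' <= K)%N -> (0 <= (breg (z k' w) zs)%:E)%E.
  by move=> /mz[? _]; rewrite lee_fin breg_ge0.
elim: k kK => [_|k IH kK].
  apply: (@le_trans _ _ (\int[P]_w (cst Theta%:E) w)%E).
    apply: ge0_le_integral => //; [by move=> w _; exact: V0|exact: mV|].
    move=> w _; rewrite lee_fin /breg.
    have := slope_argmin_ge0 (hz0 w) Zzs; have := hTheta _ _ Zzs (hz0 w).1; lra.
  rewrite integral_probability_cst expr0 mul1r lee_fin lerDl.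
  by rewrite divr_ge0// ltW.
have {}IH := IH (ltnW kK).
pose i := Ordinal kK.
have [C C0 hC] := residual_bounded kZ (ltW al0).
have hk := mz _ (ltnW kK); have [Zk _] := hk; have [_ ZO _] := hO.
have hx : Zmeasurable (fun w => O (z k w) (xi i w)).
  by apply: Zmeasurable_oracle.
have mres := measurable_residual (ltW al0) hk hx.
have R0 w : (0 <= residual al (z k w) (O (z k w) (xi i w)) + C%:E)%E.
  have [h -> ] := hC _ _ (Zk w) (ZO _ (xi i w) (Zk w)).
  by rewrite -EFinD lee_fin ler_norml => /andP[]; lra.
have hres : (\int[P]_w (residual al (z k w) (O (z k w) (xi i w)) + C%:E)
    <= (eps + C)%:E)%E.
  apply: expected_residual => // A B mA mB.
  apply: past_independent => //.
  have [_ mk] := Zmeasurable_iterate (ltnW kK).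
  by have := mk measurableT _ mA; rewrite setTI.
have s0 : 0 < al + mu by rewrite addr_gt0.
have step : (\int[P]_w ((al + mu)%:E * (breg (z k.+1 w) zs)%:E + C%:E) <=
   \int[P]_w (al%:E * (breg (z k w) zs)%:E +
      (residual al (z k w) (O (z k w) (xi i w)) + C%:E)))%E.
  apply: ge0_le_integral => //.
  - move=> w _; rewrite adde_ge0// mule_ge0// ?lee_fin ?(ltW s0)//; exact: V0.
  - by apply: emeasurable_funD => //; apply: measurable_funeM; exact: mV.
  - apply: emeasurable_funD; first by apply: measurable_funeM; exact: (mV _ (ltnW kK)).
    exact: emeasurable_funD.
  - move=> w _; have Zb := ZO _ (xi i w) (Zk w).
    have [h hE _] := hC _ _ (Zk w) Zb.
    rewrite hE -!EFinM -!EFinD lee_fin addrA lerD2r.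
    apply: (prox_step (ltW al0) hzs (Zk w) Zb (hz i w).1) => [v Zv|u Zu].
      by have := @prox_objective_argmin i w v (Zk w) Zv; rewrite hzh.
    exact: dot_le_residual.
move: step; rewrite ge0_integralD//; last 2 first.
- by move=> w _; rewrite mule_ge0// ?lee_fin ?(ltW s0)//; exact: V0.
- by apply: measurable_funeM; exact: mV.
rewrite ge0_integralZl//; [|exact: mV|by move=> w _; exact: V0|by rewrite lee_fin ltW].
rewrite integral_probability_cst.
rewrite ge0_integralD//; last 3 first.
- by move=> w _; rewrite mule_ge0// ?lee_fin ?(ltW al0)//; exact: V0 (ltnW kK).
- by apply: measurable_funeM; exact: mV (ltnW kK).
- exact: emeasurable_funD.
rewrite ge0_integralZl//; last 3 first.
- exact: mV (ltnW kK).
- by move=> w _; exact: V0 (ltnW kK).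
- by rewrite lee_fin ltW.
move=> step.
have : ((al + mu)%:E * \int[P]_w (breg (z k.+1 w) zs)%:E + C%:E <=
  (al * ((al / (mu + al)) ^+ k * Theta + eps / mu) + (eps + C))%:E)%E.
  apply: le_trans step _; rewrite EFinD EFinM; apply: leeD => //.
  by rewrite lee_pmul2l// lte_fin.
(* Nonnegativity excludes [-oo] and the bound just obtained excludes [+oo], so the inequality can be
   divided by [al + mu] in the reals. *)
have : (0 <= \int[P]_w (breg (z k.+1 w) zs)%:E)%E.
  by apply: integral_ge0 => w _; exact: V0.
case: (\int[P]_w _)%E => [I| |]//; last by rewrite gt0_muley ?lte_fin.
rewrite -EFinM -EFinD !lee_fin => _ h.
rewrite -(ler_pM2l s0) -(lerD2r C); apply: le_trans h _.
rewrite exprS le_eqVlt; apply/orP; left; apply/eqP; field.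
by rewrite !gt_eqF// addr_gt0.
Qed.

End ExpectedDecay.

End RelativeGeometry.

(** The integral of a nonnegative function is a supremum over the simple functions below it, so
    monotonicity holds for arbitrary functions. It is applied to the gap, whose measurability is not
    established. *)
Lemma ge0_le_integral_lower (R : realType) (dT : measure_display)
    (T : measurableType dT) (P : {measure set T -> \bar R}) (f1 f2 : T -> \bar R) :
  (forall x, 0 <= f1 x)%E -> (forall x, f1 x <= f2 x)%E ->
  (\int[P]_x f1 x <= \int[P]_x f2 x)%E.
Proof.
move=> f10 f12; rewrite !ge0_integralTE// => [|x]; last exact: le_trans (f12 x).
apply: ereal_sup_le => _ [h hf <-]; exists h => // x.
exact: le_trans (hf x) (f12 x).
Qed.

(** The choice [c = Num.sqrt B] is optimal when [B] is positive; for [B = 0], [c] is taken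
    arbitrarily small. *)
Lemma le_sqrt_AMGM (R : realType) (I : \bar R) (k B : R) : 0 <= k -> 0 <= B ->
  (forall c, 0 < c -> (I <= (k * (2^-1 * (B / c + c)))%:E)%E) ->
  (I <= (k * Num.sqrt B)%:E)%E.
Proof.
move=> k0; rewrite le_eqVlt => /orP[/eqP <-|B0] h; last first.
  have c0 : 0 < Num.sqrt B by rewrite sqrtr_gt0.
  apply: le_trans (h _ c0) _; rewrite lee_fin ler_wpM2l//.
  rewrite -{1}(sqr_sqrtr (ltW B0)) expr2 mulfK ?gt_eqF//; lra.
rewrite sqrtr0 mulr0; apply/lee_addgt0Pr => e e0; rewrite add0e.
have k1 : 0 < k + 1 by rewrite ltr_wpDl.
apply: le_trans (h _ (divr_gt0 e0 k1)) _; rewrite lee_fin mul0r add0r.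
have -> : k * (2^-1 * (e / (k + 1))) = e * (2^-1 * (k / (k + 1))).
  by field; rewrite gt_eqF.
rewrite ler_piMr// ?(ltW e0)//.
have : k / (k + 1) <= 1 by rewrite ler_pdivrMr// mul1r lerDl.
lra.
Qed.

Lemma cvg0_within_dnbhs (R : realType) (V : normedModType R) (Z : set V)
    (phi : V -> R) z e : phi @ within Z z^' --> (0 : R) -> 0 < e ->
  exists2 dl, 0 < dl & forall y, Z y -> y != z -> `|y - z| < dl -> `|phi y| < e.
Proof.
move=> /cvgrPdist_lt h e0; have := h _ e0.
rewrite near_withinE /= near_withinE => /nbhs_normP[dl /= dl0 hdl].
exists dl => // y Zy yz yzdl.
have := hdl y; rewrite /ball_ /= distrC => /(_ yzdl yz Zy).
by rewrite sub0r normrN.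
Qed.

Lemma dual_norm_dot (R : realType) (d : nat) (N : 'rV[R]_d -> R) q G w :
  is_norm N -> (dual_norm N q <= G%:E)%E -> dot q w <= G * N w.
Proof.
move=> [tri hom def] hG.
have N0 : N 0 = 0 by rewrite -(scale0r 0) hom normr0 mul0r.
have Nopp u : N (- u) = N u by rewrite -scaleN1r hom normrN1 mul1r.
have Nge0 : 0 <= N w by have := tri w (- w); rewrite subrr N0 Nopp; lra.
have [/def ->|Nw] := eqVneq (N w) 0; first by rewrite dot0r N0 mulr0.
have Nw0 : 0 < N w by rewrite lt_neqAle eq_sym Nw.
rewrite -ler_pdivrMr// mulrC -dotZr -lee_fin; apply: le_trans hG.
apply: ereal_sup_ubound; exists ((N w)^-1 *: w) => //=.
by rewrite hom ger0_norm ?invr_ge0// mulVf.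
Qed.

Lemma dual_norm_ge0 (R : realType) (d : nat) (N : 'rV[R]_d -> R) q :
  is_norm N -> (0 <= dual_norm N q)%E.
Proof.
move=> [_ hom _]; apply: ereal_sup_ubound; exists 0; last by rewrite dot0r.
by rewrite /= -(scale0r 0) hom normr0 mul0r.
Qed.

(** * Gradients and the duality gap *)

Section Gradient.
Context {R : realType} {d : nat}.
Variables (Z : set 'rV[R]_d) (F : 'rV[R]_d -> R) (u v q : 'rV[R]_d).
Hypothesis segZ : forall t, 0 <= t -> t <= 1 -> Z (u + t *: (v - u)).
Hypothesis hq : gradient_within Z F u q.

Lemma gradient_segment e : 0 < e -> exists2 t, 0 < t <= 1 &
  `|F (u + t *: (v - u)) - F u - t * dot q (v - u)| <= t * e.
Proof.
move=> e0.
(* The case [v = u] is apart because the error in the derivative is measured relative to [v - u]. *)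
have [vu|vu] := eqVneq v u.
  exists 1; first by rewrite ltr01 lexx.
  by rewrite vu subrr dot0r scaler0 addr0 subrr mulr0 subrr normr0 mul1r ltW.
have n0 : 0 < `|v - u| by rewrite normr_gt0 subr_eq0.
have [dl dl0 hdl] := cvg0_within_dnbhs hq (divr_gt0 e0 n0).
pose t := Num.min 1 (dl / `|v - u| / 2).
have t0 : 0 < t by rewrite lt_min ltr01 !divr_gt0.
have t1 : t <= 1 by rewrite ge_min lexx.
exists t; first by rewrite t0.
have E : u + t *: (v - u) - u = t *: (v - u) by rewrite addrAC subrr add0r.
have nE : `|t *: (v - u)| = t * `|v - u| by rewrite normrZ gtr0_norm.
have := hdl (u + t *: (v - u)) (segZ (ltW t0) t1); rewrite E nE.
have -> : u + t *: (v - u) != u by rewrite -subr_eq0 E -normr_gt0 nE mulr_gt0.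
have -> : t * `|v - u| < dl.
  rewrite -ltr_pdivlMr// gt_min; apply/orP; right.
  by rewrite ltr_pdivrMr// ltr_pMr ?divr_gt0// ltr1n.
move=> /(_ isT isT); rewrite dotZr normrM normfV (gtr0_norm (mulr_gt0 t0 n0)).
rewrite ltr_pdivrMr ?mulr_gt0// => /ltW /le_trans; apply.
by rewrite mulrCA divfK// gt_eqF.
Qed.

Lemma convex_gradient_le :
  (forall t, 0 <= t -> t <= 1 -> F (u + t *: (v - u)) <= F u + t * (F v - F u)) ->
  dot q (v - u) <= F v - F u.
Proof.
move=> cF; apply/ler_addgt0Pr => e e0.
have [t /andP[t0 t1]] := gradient_segment e0.
rewrite ler_norml => /andP[h _]; have := cF _ (ltW t0) t1.
by move=> h2; rewrite -(ler_pM2l t0); lra.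
Qed.

Lemma concave_gradient_ge :
  (forall t, 0 <= t -> t <= 1 -> F u + t * (F v - F u) <= F (u + t *: (v - u))) ->
  F v - F u <= dot q (v - u).
Proof.
move=> cF; apply/ler_addgt0Pr => e e0.
have [t /andP[t0 t1]] := gradient_segment e0.
rewrite ler_norml => /andP[_ h]; have := cF _ (ltW t0) t1.
by move=> h2; rewrite -(ler_pM2l t0); lra.
Qed.

End Gradient.

Lemma convex_set_segment (R : realType) (d : nat) (X : set 'rV[R]_d) x y t :
  convex_set X -> X x -> X y -> 0 <= t -> t <= 1 -> X (x + t *: (y - x)).
Proof.
move=> cX Xx Xy t0 t1.
have -> : x + t *: (y - x) = t *: y + (1 - t) *: x.
  by apply/rowP => i; rewrite !mxE; ring.
exact: set_mem (cX _ _ (Itv01 t0 t1) (mem_set Xy) (mem_set Xx)).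
Qed.

Lemma convex_function_segment (R : realType) (d : nat) (X : set 'rV[R]_d)
    (f : 'rV[R]_d -> R) x y t :
  convex_function X f -> X x -> X y -> 0 <= t -> t <= 1 ->
  f (x + t *: (y - x)) <= f x + t * (f y - f x).
Proof.
move=> cf Xx Xy t0 t1.
have h : f (t *: y + (1 - t) *: x) <= t * f y + (1 - t) * f x.
  exact: cf (Itv01 t0 t1) _ _ (mem_set Xy) (mem_set Xx).
have -> : x + t *: (y - x) = t *: y + (1 - t) *: x.
  by apply/rowP => i; rewrite !mxE; ring.
by lra.
Qed.

(** * The product domain and the gap of a convex-concave function *)

Section ProductDomain.
Context {R : realType} {n m : nat}.
Variables (X : set 'rV[R]_n) (Y : set 'rV[R]_m).
Local Notation Z := (product_domain X Y).

Lemma product_domain_segment z u t : convex_set X -> convex_set Y ->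
  Z z -> Z u -> 0 <= t -> t <= 1 -> Z (z + t *: (u - z)).
Proof.
move=> cX cY [Xz Yz] [Xu Yu] t0 t1.
by split; rewrite linearD linearZ linearB; apply: convex_set_segment.
Qed.

Lemma compact_product_domain : compact X -> compact Y -> compact Z.
Proof.
move=> kX kY; apply: bounded_closed_compact.
  have [M1 [_ hM1]] := compact_bounded kX.
  have [M2 [_ hM2]] := compact_bounded kY.
  exists (`|M1| + `|M2| + 1); split; first exact: num_real.
  move=> M hM z [/= Xz Yz].
  have {}hM1 := hM1 (`|M1| + 1) _ _ Xz.
  have {}hM2 := hM2 (`|M2| + 1) _ _ Yz.
  have {}hM1 : `|lsubmx z| <= `|M1| + 1.
    by apply: hM1; rewrite (le_lt_trans (ler_norm _))// ltrDl.
  have {}hM2 : `|rsubmx z| <= `|M2| + 1.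
    by apply: hM2; rewrite (le_lt_trans (ler_norm _))// ltrDl.
  have M0 : 0 < M by rewrite (le_lt_trans _ hM)// !addr_ge0.
  apply/ltW; apply: norm_lt_coord => // i; rewrite -(splitK i).
  case: (fintype.split i) => j /=.
    have := normr_coord (lsubmx z) j; rewrite mxE => /le_lt_trans; apply.
    by apply: le_lt_trans hM1 (le_lt_trans _ hM); rewrite lerD2r lerDl.
  have := normr_coord (rsubmx z) j; rewrite mxE => /le_lt_trans; apply.
  by apply: le_lt_trans hM2 (le_lt_trans _ hM); rewrite lerD2r lerDr.
apply: closedI.
  apply: (@preimage_closed _ _ lsubmx) => [z _|]; first exact: continuous_lsubmx.
  exact: compact_closed.
apply: (@preimage_closed _ _ rsubmx) => [z _|]; first exact: continuous_rsubmx.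
exact: compact_closed.
Qed.

Lemma dot_row_mx (a c : 'rV[R]_n) (b e : 'rV[R]_m) :
  dot (row_mx a b) (row_mx c e) = dot a c + dot b e.
Proof.
rewrite /dot big_split_ord /=; congr (_ + _); apply: eq_bigr => i _.
  by rewrite !row_mxEl.
by rewrite !row_mxEr.
Qed.

Variables (f : 'rV[R]_n -> 'rV[R]_m -> R).
Variables (fx : 'rV[R]_(n + m) -> 'rV[R]_n) (fy : 'rV[R]_(n + m) -> 'rV[R]_m).
Hypotheses (cX : convex_set X) (cY : convex_set Y).
Hypothesis hf : forall u, Z u ->
  gradient_within Z (fun v => f (lsubmx v) (rsubmx v)) u (row_mx (fx u) (fy u)).
Hypothesis ccf : convex_concave X Y f.

Lemma product_domain_row x y : X x -> Y y -> Z (row_mx x y).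
Proof. by move=> Xx Yy; split; rewrite ?row_mxKl ?row_mxKr. Qed.

Lemma gradient_x_le x x' y : X x -> X x' -> Y y ->
  dot (fx (row_mx x y)) (x' - x) <= f x' y - f x y.
Proof.
move=> Xx Xx' Yy; have Zu := product_domain_row Xx Yy.
have Zv := product_domain_row Xx' Yy.
have := convex_gradient_le (fun t => product_domain_segment cX cY Zu Zv) (hf Zu).
rewrite !row_mxKl !row_mxKr.
have -> : row_mx x' y - row_mx x y = row_mx (x' - x) 0.
  by rewrite opp_row_mx add_row_mx subrr.
rewrite dot_row_mx dot0r addr0; apply => t t0 t1.
have -> : row_mx x y + t *: row_mx (x' - x) 0 = row_mx (x + t *: (x' - x)) y.
  by rewrite scale_row_mx scaler0 add_row_mx addr0.
rewrite row_mxKl row_mxKr; exact: (@convex_function_segment _ _ X (f^~ y) x x' t (ccf.1 y Yy)).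
Qed.

Lemma gradient_y_ge x y y' : X x -> Y y -> Y y' ->
  f x y' - f x y <= dot (fy (row_mx x y)) (y' - y).
Proof.
move=> Xx Yy Yy'; have Zu := product_domain_row Xx Yy.
have Zv := product_domain_row Xx Yy'.
have := concave_gradient_ge (fun t => product_domain_segment cX cY Zu Zv) (hf Zu).
rewrite !row_mxKl !row_mxKr.
have -> : row_mx x y' - row_mx x y = row_mx 0 (y' - y).
  by rewrite opp_row_mx add_row_mx subrr.
rewrite dot_row_mx dot0r add0r; apply => t t0 t1.
have -> : row_mx x y + t *: row_mx 0 (y' - y) = row_mx x (y + t *: (y' - y)).
  by rewrite scale_row_mx scaler0 add_row_mx addr0.
rewrite row_mxKl row_mxKr.
by have := convex_function_segment (ccf.2 _ Xx) Yy Yy' t0 t1; lra.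
Qed.

Lemma gap_ge0 z : Z z -> (0 <= gap X Y f z)%E.
Proof.
move=> [Xz Yz]; rewrite -(subee (x := (f (lsubmx z) (rsubmx z))%:E))//.
apply: leeB; first by apply: ereal_sup_ubound; exists (rsubmx z).
by apply: ereal_inf_lbound; exists (lsubmx z).
Qed.

Variables (N : 'rV[R]_(n + m) -> R) (g : 'rV[R]_(n + m) -> 'rV[R]_(n + m)) (G : R).
Hypothesis hN : is_norm N.
Hypothesis hg : forall u, Z u -> g u = row_mx (fx u) (- fy u).
Hypothesis hG : forall u v, Z u -> Z v -> (dual_norm N (row_mx (fx u) (- fy v)) <= G%:E)%E.

(* Writing z = (a, b) and zs = (xs, ys) for the saddle point, replace (a, y) by
   (xs, y) and (x, b) by (x, ys): the two first-order bounds add up to the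
   pairing of z - zs with a gradient whose two components are taken at
   different points, as in the hypothesis on G. *)
Lemma gap_le_norm z zs : VI_solution Z g zs -> Z z -> (gap X Y f z <= (G * N (z - zs))%:E)%E.
Proof.
move=> [Zzs hzs] [Xz Yz]; have [Xs Ys] := Zzs.
set a := lsubmx z in Xz *; set b := rsubmx z in Yz *.
set xs := lsubmx zs in Xs *; set ys := rsubmx zs in Ys *.
have zE : z = row_mx a b by rewrite hsubmxK.
have zsE : zs = row_mx xs ys by rewrite hsubmxK.
have hs x y : X x -> Y y -> dot (fx zs) (xs - x) - dot (fy zs) (ys - y) <= 0.
  move=> Xx Yy; rewrite -lee_fin; apply: le_trans hzs; apply: ereal_sup_ubound.
  exists (row_mx x y); first exact: product_domain_row.
  by rewrite hg// {3}zsE opp_row_mx add_row_mx dot_row_mx dotNl.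
(* The variational inequality is tested at [(x, ys)] and [(xs, y)], which isolates one component of
   the gradient each time. *)
have saddle x y : X x -> Y y -> f xs y <= f x ys.
  move=> Xx Yy.
  have h1 := gradient_x_le Xs Xx Ys; have h2 := gradient_y_ge Xs Ys Yy.
  have := hs _ _ Xx Ys; have := hs _ _ Xs Yy.
  move: h1 h2; rewrite -zsE !subrr !dot0r !dotBr; lra.
have key x y : X x -> Y y -> f a y - f x b <= G * N (z - zs).
  move=> Xx Yy.
  have h1 := gradient_x_le Xz Xs Yy; have h2 := gradient_y_ge Xx Yz Ys.
  have h3 := saddle _ _ Xx Yy.
  have Zu := product_domain_row Xz Yy; have Zv := product_domain_row Xx Yz.
  have := dual_norm_dot (z - zs) hN (hG Zu Zv).
  rewrite {1}zE {1}zsE opp_row_mx add_row_mx dot_row_mx dotNl.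
  move: h1 h2; rewrite !dotBr; lra.
(* Finite bounds on both sides of the infimum turn the subtraction in [gap] into one of reals. *)
have I1 : (ereal_inf [set (f x b)%:E | x in X] <= (f a b)%:E)%E.
  by apply: ereal_inf_lbound; exists a.
have I2 y : Y y -> ((f a y - G * N (z - zs))%:E <= ereal_inf [set (f x b)%:E | x in X])%E.
  move=> Yy; apply: le_ereal_inf_tmp => _ [x Xx <-]; rewrite lee_fin.
  by have := key x y Xx Yy; lra.
rewrite /gap -/a -/b; move: I1 I2; case: (ereal_inf _) => [i| |] I1 I2.
- rewrite leeBlDr//; apply: ge_ereal_sup => _ [y Yy <-].
  by have := I2 _ Yy; rewrite -EFinD !lee_fin; lra.
- by [].
- by have := I2 _ Yz.
Qed.

End ProductDomain.
(* z k is the iterate z_k and zh k is the half-step z_{k+1/2}. *)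
Theorem proposition5 (R : realType) (n m : nat)
    (X : set 'rV[R]_n) (Y : set 'rV[R]_m)
    (hXc : convex_set X) (hXk : compact X)
    (hYc : convex_set Y) (hYk : compact Y)
    (N : 'rV[R]_(n + m) -> R) (hN : is_norm N)
    (r : 'rV[R]_(n + m) -> R)
    (hr : distance_generating N (product_domain X Y) r)
    (Theta : R)
    (hTheta : (ereal_sup [set (r z)%:E | z in product_domain X Y]
               - ereal_inf [set (r z)%:E | z in product_domain X Y]
               <= Theta%:E)%E)
    (mu : R) (hmu : 0 < mu)
    (g : 'rV[R]_(n + m) -> 'rV[R]_(n + m))
    (hgc : {within product_domain X Y, continuous g})
    (hgm : strongly_monotone_rel mu (product_domain X Y) r g)
    (alpha eps : R) (halpha : 0 < alpha) (heps : 0 <= eps)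
    (dS : measure_display) (S : measurableType dS) (Q : probability S R)
    (O : 'rV[R]_(n + m) -> S -> 'rV[R]_(n + m))
    (hO : relaxed_proximal_oracle (product_domain X Y) r g alpha eps Q O)
    (zs : 'rV[R]_(n + m)) (hzs : VI_solution (product_domain X Y) g zs)
    (K : nat)
    (dO : measure_display) (Omega : measurableType dO)
    (P : probability Omega R)
    (xi : 'I_K -> {mfun Omega >-> S})
    (hxi_law : forall k (A : set S), measurable A -> P (xi k @^-1` A) = Q A)
    (hxi_ind : mutually_independent P xi)
    (z zh : nat -> Omega -> 'rV[R]_(n + m))
    (hz0 : forall w, is_argmin (product_domain X Y) (EFin \o r) (z 0%N w))
    (hzh : forall (k : 'I_K) w, zh k w = O (z k w) (xi k w))
    (hz : forall (k : 'I_K) w,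
       is_argmin (product_domain X Y)
         (fun u => (dot (g (zh k w)) u)%:E
                   + alpha%:E * bregman (product_domain X Y) r (z k w) u
                   + mu%:E * bregman (product_domain X Y) r (zh k w) u)%E
         (z k.+1 w)) :
  (\int[P]_w bregman (product_domain X Y) r (z K w) zs
     <= ((alpha / (mu + alpha)) ^+ K * Theta + eps / mu)%:E)%E
  /\
  (forall (f : 'rV[R]_n -> 'rV[R]_m -> R)
      (fx : 'rV[R]_(n + m) -> 'rV[R]_n) (fy : 'rV[R]_(n + m) -> 'rV[R]_m)
      (G : R),
    (forall u, product_domain X Y u ->
       gradient_within (product_domain X Y)
         (fun v => f (lsubmx v) (rsubmx v)) u (row_mx (fx u) (fy u))) ->
    convex_concave X Y f ->
    (forall u, product_domain X Y u -> g u = row_mx (fx u) (- fy u)) ->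
    (forall u v, product_domain X Y u -> product_domain X Y v ->
       (dual_norm N (row_mx (fx u) (- fy v)) <= G%:E)%E) ->
    (\int[P]_w gap X Y f (z K w)
       <= (Num.sqrt 2 * G *
           Num.sqrt ((alpha / (mu + alpha)) ^+ K * Theta + eps / mu))%:E)%E).
Proof.
set Z := product_domain X Y in hr hTheta hgc hgm hO hzs hz0 hz *.
have segZ z1 u t : Z z1 -> Z u -> 0 <= t -> t <= 1 -> Z (z1 + t *: (u - z1)).
  exact: product_domain_segment.
have kZ : compact Z by exact: compact_product_domain.
have cZ : closed Z by apply: compact_closed => //; exact: norm_hausdorff.
have Zzs := hzs.1.
have rTheta u v : Z u -> Z v -> r u - r v <= Theta.
  move=> Zu Zv; rewrite -lee_fin EFinB; apply: le_trans hTheta.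
  by apply: leeB; [apply: ereal_sup_ubound; exists u|apply: ereal_inf_lbound; exists v].
have [Zm mm] := Zmeasurable_iterate hN cZ segZ hr hmu hgc hgm halpha hO hz0 hzh hz (leqnn K).
have mK := measurable_past mm.
set B := _ * Theta + _.
have decay : (\int[P]_w (breg Z r (z K w) zs)%:E <= B%:E)%E.
  exact: (expected_breg_decay hN cZ segZ hr hmu hgc hgm kZ halpha hO hzs hxi_law hxi_ind
    hz0 hzh hz (leqnn K) rTheta heps).
split.
  by under eq_integral do rewrite (bregmanE hmu hgm (Zm _) Zzs).
move=> f fx fy G hf ccf hg hG.
have V0 w : 0 <= breg Z r (z K w) zs by exact: (breg_ge0 hr hmu hgm).
have B0 : 0 <= B.
  by rewrite -lee_fin; apply: le_trans decay; apply: integral_ge0 => w _; rewrite lee_fin.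
have G0 : 0 <= G.
  by rewrite -lee_fin; apply: le_trans (hG _ _ Zzs Zzs); exact: dual_norm_ge0.
have mV : measurable_fun setT (fun w => (breg Z r (z K w) zs)%:E).
  apply/measurable_EFinP.
  exact: (@measurable_breg _ _ N Z r mu g cZ segZ hr hmu hgc hgm _ _ (z K) zs
    (conj Zm mK) Zzs).
apply: le_sqrt_AMGM => // [|c c0]; first by rewrite mulr_ge0.
(* For fixed [c] the bound on the gap is affine in the divergence and can be integrated term by
   term; the factor [2^-1] is that of the arithmetic-geometric mean inequality. *)
pose k := Num.sqrt 2 * G * 2^-1.
have k0 : 0 <= k by rewrite !mulr_ge0// invr_ge0.
have gapV w : (gap X Y f (z K w) <= (k / c)%:E * (breg Z r (z K w) zs)%:E + (k * c)%:E)%E.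
  apply: le_trans (gap_le_norm hXc hYc hf ccf hN hg hG hzs (Zm w)) _.
  rewrite -EFinM -EFinD lee_fin; set V := breg Z r (z K w) zs.
  have Nsym : N (z K w - zs) = N (zs - z K w).
    by have [_ hom _] := hN; rewrite -opprB -scaleN1r hom normrN1 mul1r.
  have : N (zs - z K w) <= Num.sqrt 2 * Num.sqrt V.
    rewrite -sqrtrM// (le_trans (ler_norm _))// -sqrtr_sqr ler_wsqrtr//.
    by have := breg_ge_sqr hr hmu hgm (Zm w) Zzs; rewrite -/V; lra.
  have : Num.sqrt V <= 2^-1 * (V / c + c).
    have := sqr_ge0 (Num.sqrt V - c); rewrite sqrrB sqr_sqrtr ?V0// => h.
    rewrite -(ler_pM2r c0) -mulrA mulrDl divfK ?gt_eqF//.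
    by move: h; rewrite !expr2; lra.
  move=> hV hNV; rewrite Nsym.
  have -> : k / c * V + k * c = G * (Num.sqrt 2 * (2^-1 * (V / c + c))).
    by rewrite /k; ring.
  by rewrite ler_wpM2l// (le_trans hNV)// ler_wpM2l.
apply: (@le_trans _ _
    (\int[P]_w ((k / c)%:E * (breg Z r (z K w) zs)%:E + (k * c)%:E))%E).
  by apply: ge0_le_integral_lower => // w; exact: (gap_ge0 f (Zm w)).
rewrite ge0_integralD//; last 3 first.
- by move=> w _; apply: mule_ge0; rewrite lee_fin// divr_ge0// ltW.
- exact: measurable_funeM.
- by move=> w _; rewrite lee_fin mulr_ge0// ltW.
rewrite ge0_integralZl//; last 2 first.
- by move=> w _; rewrite lee_fin.
- by rewrite lee_fin divr_ge0// ltW.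
rewrite integral_probability_cst.
have -> : Num.sqrt 2 * G * (2^-1 * (B / c + c)) = k / c * B + k * c.
  by rewrite /k; ring.
rewrite EFinD leeD2r// [leRHS]EFinM; apply: lee_wpmul2l => //.
by rewrite lee_fin divr_ge0// ltW.
Qed.
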